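(* Let $(\mathcal{E},\mathcal{D}(\mathcal{E}))$ be a regular, irreducible, transient Dirichlet form on $L^2(E;m)$, and let $\mu$ be a positive smooth Radon measure on $E$ such that the form $\mathcal{E}^\mu(u,v)=\mathcal{E}(u,v)-\int_Euv\,d\mu$ on $\mathcal{D}(\mathcal{E})\cap C_0(E)$ is positive semi-definite and closable in $L^2(E;m)$, with closure $(\mathcal{E}^\mu,\mathcal{D}(\mathcal{E}^\mu))$. Suppose $(\mathcal{E}^\mu,\mathcal{D}(\mathcal{E}^\mu))$ is critical and let $\phi$ be the ground state. Then $\phi$ belongs to $\mathcal{H}^+(\mu)$; more precisely, $T^\mu_t\phi=\phi$ $m$-a.e. for all $t>0$.
   Context: $E$ is a locally compact separable metric space, $m$ a positive Radon measure on $E$ with full topological support, $C_0(E)$ the continuous functions with compact support; $a(u)=a(u,u)$. Irreducible: if a measurable $A\subset E$ satisfies $T_t(1_Af)=1_AT_tf$ $m$-a.e. for all $f\in L^2(E;m)$, $t>0$ ($T_t$ the semigroup of $\mathcal{E}$), then $m(A)=0$ or $m(A^c)=0$. Transient: there is a bounded $g\in L^1(E;m)$, $g>0$ $m$-a.e., with $\int_E|u|g\,dm\le\sqrt{\mathcal{E}(u)}$ for $u\in\mathcal{D}(\mathcal{E})$. A positive Borel measure is smooth if it charges no set of zero capacity and there are increasing closed sets $F_n$ with $\mu(F_n)<\infty$ and $\lim_n\mathrm{Cap}(K\setminus F_n)=0$ for every compact $K$ (Cap is the 1-capacity of $\mathcal{E}$). $\mathcal{D}_e(\mathcal{E}^\mu)$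 (extended Schrödinger space) is the set of $m$-measurable $u$ with $|u|<\infty$ $m$-a.e. for which there is an $\mathcal{E}^\mu$-Cauchy sequence $u_n\in\mathcal{D}(\mathcal{E}^\mu)$ with $u_n\to u$ $m$-a.e.; $\mathcal{E}^\mu(u)=\lim_n\mathcal{E}^\mu(u_n)$. Critical: there is $\phi\in\mathcal{D}_e(\mathcal{E}^\mu)$, $\phi>0$ $m$-a.e., with $\mathcal{E}^\mu(\phi)=0$; such a $\phi$ is called the ground state. $\{T^\mu_t\}$ is the $L^2(E;m)$-semigroup of $(\mathcal{E}^\mu,\mathcal{D}(\mathcal{E}^\mu))$; it is positivity preserving and is extended to non-negative measurable functions by monotone limits. $\mathcal{H}^+(\mu)=\{h:0<h<\infty\ m\text{-a.e.},\ T^\mu_th\le h\ m\text{-a.e. for all }t>0\}$. *)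

(* Defs.v *)
From HB Require Import structures.
From mathcomp Require Import all_boot all_order all_algebra.
From mathcomp Require Import all_classical all_reals all_analysis measurable_realfun.

Set Implicit Arguments.
Unset Strict Implicit.
Unset Printing Implicit Defensive.

Import Order.TTheory GRing.Theory Num.Theory.
Import numFieldNormedType.Exports.

Local Open Scope classical_set_scope.
Local Open Scope ring_scope.

(* Measurable types of the library are pointed, hence so are the metric spaces
   considered here (i.e., they are non-empty). *)
#[short(type="pmetricType")]
HB.structure Definition PMetric (K : numDomainType) :=
  {M of Pointed M & Metric K M}.

(* E with its Borel sigma-algebra. *)
Notation borel E := (g_sigma_algebraType (@open E)).

(* Elements of L^2(E; m) are handled through Borel representatives
   u : E -> R with u \in Lfun m 2, and all identities between them are only
   required m-a.e.  A form is a domain together with a function on pairs,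
   whose values outside the domain are irrelevant. *)
Record l2form (R : realType) (E : pmetricType R) := L2Form {
  dom : set (E -> R) ;
  val_form :> (E -> R) -> (E -> R) -> R }.

Section Space.
Context (R : realType) (E : pmetricType R).
Implicit Types nu : {measure set (borel E) -> \bar R}.

Definition separable := exists2 D : set E, countable D & dense D.

(* On a locally compact separable metric space every Borel measure that is
   finite on compact sets is regular. *)
Definition radon nu := forall K : set E, compact K -> (nu K < +oo)%E.

Definition full_support nu :=
  forall U : set E, open U -> U !=set0 -> (0 < nu U)%E.

Definition C0 : set (E -> R) :=
  [set u : E -> R | continuous u /\ compact (closure [set x | u x != 0])].

End Space.

Section Forms.
Context (R : realType) (E : pmetricType R).
Variable m : {measure set (borel E) -> \bar R}.
Implicit Types (a : l2form E) (u v f g : E -> R) (s : nat -> E -> R).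

Definition L2 : set (E -> R) := [set u : E -> R | u \in Lfun m 2%:E].
Definition L2norm u : \bar R := ('N[m]_2%:E [EFin \o u])%E.
Definition ip u v : R := (\int[m]_x (u x * v x))%R.
Definition L2cvg s u := L2norm (s n \- u) @[n --> \oo] --> 0%E.

Definition form1 a u v : R := a u v + ip u v.

Definition energy_cauchy a s := forall e : R, 0 < e ->
  exists N, forall i j, (N <= i)%N -> (N <= j)%N -> a (s i \- s j) (s i \- s j) < e.

Definition psd a := forall u, dom a u -> 0 <= a u u.

Record symm_form a : Prop := {
  dom_L2 : dom a `<=` L2 ;
  dom0 : dom a (cst 0) ;
  domP : forall c u v, dom a u -> dom a v -> dom a (fun x => c * u x + v x) ;
  dom_ae : forall u v, dom a u -> L2 v -> {ae m, forall x, u x = v x} -> dom a v ;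
  form_ae : forall u v w, dom a u -> dom a v -> dom a w ->
    {ae m, forall x, u x = v x} -> a u w = a v w ;
  form_linear : forall c u v w, dom a u -> dom a v -> dom a w ->
    a (fun x => c * u x + v x) w = c * a u w + a v w ;
  form_sym : forall u v, dom a u -> dom a v -> a u v = a v u ;
  form_psd : psd a ;
  dom_dense : forall f (e : R), L2 f -> 0 < e ->
    exists2 u, dom a u & (L2norm (f \- u)%R < e%:E)%E }.

Definition closed_form a := forall s, (forall n, dom a (s n)) ->
  (forall e : R, 0 < e -> exists N, forall i j, (N <= i)%N -> (N <= j)%N ->
     form1 a (s i \- s j) (s i \- s j) < e) ->
  exists2 u, dom a u & form1 a (s n \- u) (s n \- u) @[n --> \oo] --> (0 : R).

Definition markovian a := forall u, dom a u ->
  let v := fun x => Num.min (Num.max (u x) 0) 1 in dom a v /\ a v v <= a u u.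

Definition dirichlet_form a :=
  [/\ symm_form a, closed_form a & markovian a].

Definition regular a :=
  (forall u (e : R), dom a u -> 0 < e -> exists2 v, (dom a `&` @C0 R E) v &
     form1 a (u \- v) (u \- v) < e) /\
  (forall u (e : R), @C0 R E u -> 0 < e -> exists2 v, (dom a `&` @C0 R E) v &
     forall x, `|u x - v x| < e).

Definition transient a := exists g : E -> R,
  [/\ g \in Lfun m 1, exists M : R, forall x, `|g x| <= M,
      {ae m, forall x, 0 < g x} &
      forall u, dom a u ->
        (\int[m]_x (`|u x| * g x)%:E <= (Num.sqrt (a u u))%:E)%E].

(* The 1-capacity: ereal_inf set0 = +oo. *)
Definition cap_open a (A : set E) : \bar R :=
  ereal_inf [set (form1 a u u)%:E | u in
    [set u | dom a u /\ {ae m, forall x, A x -> 1 <= u x}]].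
Definition cap a (A : set E) : \bar R :=
  ereal_inf [set cap_open a B | B in [set B : set E | open B /\ A `<=` B]].

Definition smooth a (mu : {measure set (borel E) -> \bar R}) :=
  (forall A : set (borel E), measurable A -> cap a A = 0%E -> mu A = 0%E) /\
  exists F : nat -> set E,
    [/\ forall n, closed (F n), forall n, F n `<=` F n.+1,
        forall n, (mu (F n) < +oo)%E &
        forall K : set E, compact K -> cap a (K `\` F n) @[n --> \oo] --> 0%E].

Definition schrodinger a (mu : {measure set (borel E) -> \bar R}) : l2form E :=
  L2Form (dom a `&` @C0 R E)
       (fun u v => a u v - (\int[mu]_x (u x * v x))%R).

Definition closable a := forall s, (forall n, dom a (s n)) ->
  energy_cauchy a s -> L2cvg s (cst 0) ->
  a (s n) (s n) @[n --> \oo] --> (0 : R).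

Definition closure_approx a u s :=
  [/\ forall n, dom a (s n), energy_cauchy a s & L2cvg s u].

(* When a is closable, the limit below exists and does not depend on the chosen
   approximating sequences. *)
Definition form_closure a : l2form E :=
  L2Form [set u | L2 u /\ exists s, closure_approx a u s]
       (fun u v => limn (fun n =>
          a (get (closure_approx a u) n) (get (closure_approx a v) n))).

(* T is the strongly continuous contraction semigroup on L^2(E; m) whose
   generator is the self-adjoint operator A associated with the closed form a,
   that is, u is in D(A) and A u = f if and only if u is in the domain of a and
   a(u, v) = - (f, v) for all v in that domain. *)
Record semigroup_of a (T : R -> (E -> R) -> (E -> R)) : Prop := {
  semigroup_L2 : forall (t : R) f, 0 < t -> L2 f -> L2 (T t f) ;
  semigroup_linear : forall (t c : R) f g, 0 < t -> L2 f -> L2 g ->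
    {ae m, forall x, T t (fun y => c * f y + g y) x = c * T t f x + T t g x} ;
  semigroup_contraction : forall (t : R) f, 0 < t -> L2 f ->
    (L2norm (T t f) <= L2norm f)%E ;
  semigroup_sym : forall (t : R) f g, 0 < t -> L2 f -> L2 g ->
    ip (T t f) g = ip f (T t g) ;
  semigroupD : forall (t r : R) f, 0 < t -> 0 < r -> L2 f ->
    {ae m, forall x, T (t + r) f x = T t (T r f) x} ;
  semigroup_cvg0 : forall f, L2 f ->
    L2norm (T t f \- f) @[t --> 0^'+] --> 0%E ;
  semigroup_generator : forall u f, L2 u -> L2 f ->
    L2norm (fun x => t^-1 * (T t u x - u x) - f x) @[t --> 0^'+] --> 0%E <->
    dom a u /\ forall v, dom a v -> a u v = - ip f v }.

Definition irreducible (T : R -> (E -> R) -> (E -> R)) :=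
  forall A : set (borel E), measurable A ->
  (forall (t : R) f, 0 < t -> L2 f ->
     {ae m, forall x, T t (\1_A \* f) x = \1_A x * T t f x}) ->
  m A = 0%E \/ m (~` A) = 0%E.

(* Measurability with respect to the m-completion of the Borel sigma-algebra. *)
Definition ae_measurable (u : E -> \bar R) :=
  exists2 v : borel E -> \bar R, measurable_fun [set: borel E] v &
    {ae m, forall x, u x = v x}.

Definition extended_approx a (u : E -> \bar R) s :=
  [/\ forall n, dom a (s n), energy_cauchy a s &
      {ae m, forall x, (s n x)%:E @[n --> \oo] --> u x}].

Definition extended_dom a : set (E -> \bar R) :=
  [set u | [/\ ae_measurable u, {ae m, forall x, (`|u x| < +oo)%E} &
               exists s, extended_approx a u s]].

(* The limit of a(u_n) along a chosen approximating sequence (u_n) of u; for the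
   forms considered here it does not depend on the choice. *)
Definition extended_form a (u : E -> \bar R) : R :=
  let s := get (extended_approx a u) in limn (fun n => a (s n) (s n)).

Definition ground_state a (phi : E -> \bar R) :=
  [/\ extended_dom a phi, {ae m, forall x, (0 < phi x)%E} &
      extended_form a phi = 0].

Definition critical a := exists phi, ground_state a phi.

(* Extension of a positivity preserving operator P on L^2(E; m) to non-negative
   measurable functions: P f is the a.e. limit of P f_n, for f_n in L^2 with
   0 <= f_n increasing to f (such f_n exist since m is sigma-finite). *)
Definition monotone_approx (f : E -> \bar R) s :=
  [/\ forall n, L2 (s n), forall n, {ae m, forall x, 0 <= s n x <= s n.+1 x} &
      {ae m, forall x, (s n x)%:E @[n --> \oo] --> f x}].

Definition monotone_ext (P : (E -> R) -> (E -> R)) (f : E -> \bar R) :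
    E -> \bar R :=
  fun x => limn (fun n => (P (get (monotone_approx f) n) x)%:E).

Definition Hplus (T : R -> (E -> R) -> (E -> R)) : set (E -> \bar R) :=
  [set h | [/\ ae_measurable h, {ae m, forall x, (0 < h x < +oo)%E} &
    forall t : R, 0 < t -> {ae m, forall x, (monotone_ext (T t) h x <= h x)%E}]].

End Forms.

(* Main.v *)
Require Import Defs.
From mathcomp Require Import all_boot all_order all_algebra.
From mathcomp Require Import all_classical all_reals all_analysis measurable_realfun.
From mathcomp Require Import ring lra.

Import Order.TTheory GRing.Theory Num.Theory.
Import numFieldNormedType.Exports.

Local Open Scope classical_set_scope.
Local Open Scope ring_scope.

(* Let q be the form E^mu, T its semigroup and phi the ground state, so that
   there are u_n in D(q) with q(u_n) -> 0 and u_n -> phi a.e.  Two facts on T are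
   needed.  It preserves positivity: the resolvent (1 + h A)^-1 f is the limit of
   a minimising sequence s_n of h q(s) + |s|^2 - 2 (f, s) in the core, for f >= 0
   one may replace s_n by |s_n|, and T_t = lim (1 + (t/n) A)^-n.  Moreover
   (u - T_t u, u) <= t q(u), by convexity of s |-> (T_s u, u).

   Put v_n = |u_n|.  Then |v_n - T_t v_n|^2 <= (v_n - T_t v_n, v_n)
   <= (u_n - T_t u_n, u_n) <= t q(u_n) -> 0.  If 0 <= f <= phi is in L^2 then
   T_t min(f, v_n) <= T_t v_n gives T_t f <= phi in the limit, hence
   T_t phi <= phi.  Consequently w_n = min(v_n, phi) satisfies
   (w_n - T_t w_n, v_n - w_n) >= 0, whence
   |w_n - T_t w_n|^2 <= (w_n - T_t w_n, w_n) <= (v_n - T_t v_n, v_n) -> 0, and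
   w_n - (w_n - T_t w_n) = T_t w_n <= T_t phi gives phi <= T_t phi. *)

(** * Positive semidefinite forms *)

(** Functions are not identified a.e., so the L^2 product is only semidefinite on the type of
    square-integrable functions. The abstract part therefore works with semidefinite forms on a
    vector space, reads equality of x and y as a vanishing seminorm of x - y, and transports
    identities through inner products.

    The form q is not Markovian: truncation shrinks the integral of u^2 against mu, which enters
    with a minus sign. The modulus keeps u^2, hence its use both for the resolvent and for v_n. It
    is also why w_n, a truncation, is controlled through (w_n - T_t w_n, w_n) rather than q(w_n).

    The function phi need not be in L^2, and u_n converges only a.e. Passages to the limit thus have
    one shape: x <= y_n + r_n with y_n convergent a.e. and r_n small in L^2, closed along indices
    for which r_n tends to 0 a.e. *)

Section RealSequences.
Context {R : realType}.

(** The discriminant criterion, with C = 0 allowed. It yields Cauchy-Schwarz and, with the defect of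
    a minimising sequence as A, an approximate Euler-Lagrange equation. *)
Lemma quad_ge0_discr (A B C : R) :
  (forall c, 0 <= A + 2 * c * B + c ^+ 2 * C) -> 0 <= C -> B ^+ 2 <= A * C.
Proof.
move=> H; rewrite le_eqVlt => /orP[/eqP C0|C0].
  have [->|B0] := eqVneq B 0; first by rewrite -C0; lra.
  (* With C = 0 the expression is affine in c, and this c gives it the value -1. *)
  have := H (- (A + 1) / (2 * B)).
  rewrite -C0 mulr0 addr0.
  have -> : A + 2 * (- (A + 1) / (2 * B)) * B = -1 by field.
  lra.
have := H (- B / C).
have -> : A + 2 * (- B / C) * B + (- B / C) ^+ 2 * C = (A * C - B ^+ 2) / C.
  by field; rewrite gt_eqF.
by rewrite pmulr_lge0 ?invr_gt0// subr_ge0.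
Qed.

Lemma cvgr0_sqrt T (F : set_system T) (FF : Filter F) (f : T -> R) :
  f x @[x --> F] --> (0 : R) -> Num.sqrt (f x) @[x --> F] --> (0 : R).
Proof.
move=> f0; rewrite -[X in _ --> X]sqrtr0.
exact: (continuous_cvg _ (@sqrt_continuous R 0)).
Qed.

Lemma cvgr0_le T (F : set_system T) (FF : Filter F) (f g : T -> R) :
  (\forall x \near F, 0 <= f x <= g x) ->
  g x @[x --> F] --> (0 : R) -> f x @[x --> F] --> (0 : R).
Proof. by move=> fg g0; apply: (squeeze_cvgr fg) => //; exact: cvg_cst. Qed.

Lemma cauchy_seq_cvg (x : R ^nat) :
  (forall e, 0 < e -> exists N, forall i j, (N <= i)%N -> (N <= j)%N ->
     `|x i - x j| < e) -> cvgn x.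
Proof.
move=> xC; apply/cauchy_cvgP/cauchy_exP => e e0.
have [N HN] := xC e e0; exists (x N); exists N => // n /= Nn.
by rewrite -ball_normE/=; exact: HN.
Qed.

End RealSequences.

(** Being relative to a domain and without definiteness, the same structure serves the L^2 product
    on functions, the core form and its closure. *)
Record psd_form {R : realType} {V : lmodType R} (D : set V) (b : V -> V -> R) :
    Prop := PsdForm {
  pf_dom0 : D 0 ;
  pf_domP : forall c u v, D u -> D v -> D (c *: u + v) ;
  pf_linear : forall c u v w, D u -> D v -> D w ->
    b (c *: u + v) w = c * b u w + b v w ;
  pf_sym : forall u v, D u -> D v -> b u v = b v u ;
  pf_ge0 : forall u, D u -> 0 <= b u u }.

Definition seminorm {R : realType} {V : lmodType R} (b : V -> V -> R) (x : V) :
  R := Num.sqrt (b x x).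

Section PsdForm.
Context {R : realType} {V : lmodType R} (D : set V) (b : V -> V -> R).
Hypothesis bP : psd_form D b.
Local Notation nm := (seminorm b).

Lemma pf_domD x y : D x -> D y -> D (x + y).
Proof. by move=> Dx Dy; rewrite -[x]scale1r; exact: (pf_domP _ _ bP). Qed.

Lemma pf_domZ c x : D x -> D (c *: x).
Proof.
by move=> Dx; rewrite -[_ *: _]addr0; apply: (pf_domP _ _ bP) => //; apply: (pf_dom0 _ _ bP).
Qed.

Lemma pf_domB x y : D x -> D y -> D (x - y).
Proof.
by move=> Dx Dy; rewrite addrC -scaleN1r; apply: (pf_domP _ _ bP).
Qed.

Lemma pfDl x y z : D x -> D y -> D z -> b (x + y) z = b x z + b y z.
Proof.
by move=> Dx Dy Dz; rewrite -{1}[x]scale1r (pf_linear _ _ bP)// mul1r.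
Qed.

Lemma pf0l z : D z -> b 0 z = 0.
Proof.
move=> Dz; have D0 := pf_dom0 _ _ bP.
have := pfDl 0 0 z D0 D0 Dz; rewrite addr0 => /eqP.
by rewrite -subr_eq0 opprD addrA subrr sub0r oppr_eq0 => /eqP.
Qed.

Lemma pfZl c x z : D x -> D z -> b (c *: x) z = c * b x z.
Proof.
move=> Dx Dz; have D0 := pf_dom0 _ _ bP.
by rewrite -{1}[_ *: _]addr0 (pf_linear _ _ bP)// pf0l// addr0.
Qed.

Lemma pfBl x y z : D x -> D y -> D z -> b (x - y) z = b x z - b y z.
Proof.
by move=> Dx Dy Dz; rewrite addrC -scaleN1r (pf_linear _ _ bP)// mulN1r addrC.
Qed.

Lemma pfDr x y z : D x -> D y -> D z -> b z (x + y) = b z x + b z y.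
Proof.
move=> Dx Dy Dz; rewrite (pf_sym _ _ bP) ?pfDl//; last exact: pf_domD.
by rewrite !(pf_sym _ _ bP _ z).
Qed.

Lemma pfZr c x z : D x -> D z -> b z (c *: x) = c * b z x.
Proof.
move=> Dx Dz; rewrite (pf_sym _ _ bP) ?pfZl//; last exact: pf_domZ.
by rewrite !(pf_sym _ _ bP _ z).
Qed.

Lemma pfBr x y z : D x -> D y -> D z -> b z (x - y) = b z x - b z y.
Proof.
move=> Dx Dy Dz; rewrite (pf_sym _ _ bP) ?pfBl//; last exact: pf_domB.
by rewrite !(pf_sym _ _ bP _ z).
Qed.

Lemma pf_sqrD c x y : D x -> D y ->
  b (x + c *: y) (x + c *: y) = b x x + 2 * c * b x y + c ^+ 2 * b y y.
Proof.
move=> Dx Dy; have Dcy := pf_domZ c _ Dy.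
rewrite pfDl ?pfDr ?pfZl ?pfZr//; last exact: pf_domD.
rewrite (pf_sym _ _ bP y x)//; ring.
Qed.

Lemma pf_sqrB x y : D x -> D y ->
  b (x - y) (x - y) = b x x - 2 * b x y + b y y.
Proof. by move=> Dx Dy; rewrite -scaleN1r pf_sqrD//; ring. Qed.

Lemma seminorm_ge0 x : 0 <= nm x. Proof. exact: sqrtr_ge0. Qed.

Lemma sqr_seminorm x : D x -> nm x ^+ 2 = b x x.
Proof. by move=> Dx; rewrite sqr_sqrtr// (pf_ge0 _ _ bP). Qed.

Lemma pf_CauchySchwarz x y : D x -> D y -> `|b x y| <= nm x * nm y.
Proof.
move=> Dx Dy; rewrite -[leLHS]sqrtr_sqr -sqrtrM ?(pf_ge0 _ _ bP)//.
rewrite ler_wsqrtr// quad_ge0_discr ?(pf_ge0 _ _ bP)// => c.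
by rewrite -pf_sqrD// (pf_ge0 _ _ bP)//; apply: pf_domD => //; exact: pf_domZ.
Qed.

Lemma pf_le x y : D x -> D y -> b x y <= nm x * nm y.
Proof. by move=> Dx Dy; apply: le_trans (ler_norm _) _; exact: pf_CauchySchwarz. Qed.

Lemma seminormD x y : D x -> D y -> nm (x + y) <= nm x + nm y.
Proof.
move=> Dx Dy; have Dxy := pf_domD _ _ Dx Dy.
rewrite -(@ler_pXn2r _ 2)// ?nnegrE ?addr_ge0 ?seminorm_ge0//.
rewrite sqr_seminorm// -[y]scale1r pf_sqrD// scale1r sqrrD !sqr_seminorm//.
by have := pf_le _ _ Dx Dy; lra.
Qed.

Lemma seminormZ c x : D x -> nm (c *: x) = `|c| * nm x.
Proof.
move=> Dx; rewrite /seminorm pfZl ?pfZr//; last exact: pf_domZ.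
by rewrite mulrA -expr2 sqrtrM ?sqr_ge0// sqrtr_sqr.
Qed.

Lemma seminormN x : D x -> nm (- x) = nm x.
Proof. by move=> Dx; rewrite -scaleN1r seminormZ// normrN1 mul1r. Qed.

Lemma seminormB x y : D x -> D y -> nm (x - y) <= nm x + nm y.
Proof.
move=> Dx Dy; rewrite -(seminormN y)//; apply: seminormD => //.
by rewrite -scaleN1r; exact: pf_domZ.
Qed.

Lemma seminorm_distC x y : D x -> D y -> nm (x - y) = nm (y - x).
Proof. by move=> Dx Dy; rewrite -opprB seminormN//; exact: pf_domB. Qed.

Lemma seminorm_dist x y : D x -> D y -> `|nm x - nm y| <= nm (x - y).
Proof.
move=> Dx Dy; have Dxy := pf_domB _ _ Dx Dy; have Dyx := pf_domB _ _ Dy Dx.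
have := seminormD _ _ Dxy Dy; rewrite subrK => h1.
have := seminormD _ _ Dyx Dx; rewrite subrK seminorm_distC// => h2.
by rewrite ler_norml; lra.
Qed.

Lemma seminorm_trans y x z : D x -> D y -> D z ->
  nm (x - z) <= nm (x - y) + nm (y - z).
Proof.
move=> Dx Dy Dz; rewrite -[x - z](subrKA y).
by apply: seminormD; exact: pf_domB.
Qed.

(** By Cauchy-Schwarz, null vectors are invisible to the form; this replaces rewriting with an a.e.
    equality. *)
Lemma pf_null x y : D x -> D y -> nm x = 0 -> b x y = 0.
Proof.
move=> Dx Dy x0; have := pf_CauchySchwarz _ _ Dx Dy.
by rewrite x0 mul0r normr_le0 => /eqP.
Qed.

Lemma pf_null_sub x y z : D x -> D y -> D z -> nm (x - y) = 0 -> b x z = b y z.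
Proof.
move=> Dx Dy Dz /pf_null => /(_ z (pf_domB _ _ Dx Dy) Dz) /eqP.
by rewrite pfBl// subr_eq0 => /eqP.
Qed.

Definition form_cauchy (s : nat -> V) := forall e : R, 0 < e ->
  exists N, forall i j, (N <= i)%N -> (N <= j)%N -> b (s i - s j) (s i - s j) < e.

Lemma form_cauchyP s : (forall n, D (s n)) ->
  form_cauchy s <-> (forall e : R, 0 < e ->
  exists N, forall i j, (N <= i)%N -> (N <= j)%N -> nm (s i - s j) < e).
Proof.
move=> Ds; split=> H e e0.
  have [N HN] := H (e ^+ 2) (exprn_gt0 _ e0).
  exists N => i j Ni Nj; rewrite -(@ltr_pXn2r _ 2)// ?nnegrE ?seminorm_ge0 ?ltW//.
  by rewrite sqr_seminorm; [exact: HN|exact: pf_domB].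
have [|N HN] := H (Num.sqrt e); first by rewrite sqrtr_gt0.
exists N => i j Ni Nj; rewrite -sqr_seminorm; last exact: pf_domB.
rewrite -(sqr_sqrtr (ltW e0)) ltr_pXn2r// ?nnegrE ?seminorm_ge0 ?sqrtr_ge0//.
exact: HN.
Qed.

Lemma form_cauchyD c s s' : (forall n, D (s n)) -> (forall n, D (s' n)) ->
  form_cauchy s -> form_cauchy s' -> form_cauchy (fun n => s n + c *: s' n).
Proof.
move=> Ds Ds' /(form_cauchyP _ Ds) Cs /(form_cauchyP _ Ds') Cs'.
apply/form_cauchyP => [n|e e0]; first by apply: pf_domD => //; exact: pf_domZ.
(* Adding 1 keeps the divisor positive when c = 0. *)
have c1 : 0 < `|c| + 1 by rewrite ltr_wpDl.
have e2 : 0 < e / 2 by lra.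
have [N HN] := Cs _ e2; have [M HM] := Cs' _ (divr_gt0 e2 c1).
exists (maxn N M) => i j; rewrite !geq_max => /andP[Ni Mi] /andP[Nj Mj].
rewrite opprD addrACA -scalerBr.
have Dij := pf_domB _ _ (Ds i) (Ds j); have Dij' := pf_domB _ _ (Ds' i) (Ds' j).
apply: le_lt_trans (seminormD _ _ Dij (pf_domZ c _ Dij')) _.
rewrite seminormZ//; have h1 := HN i j Ni Nj; have h2 := HM i j Mi Mj.
have : `|c| * nm (s' i - s' j) <= e / 2.
  apply: (@le_trans _ _ ((`|c| + 1) * (e / 2 / (`|c| + 1)))).
    by rewrite ler_pM ?seminorm_ge0 ?lerDl// ltW.
  by rewrite mulrC divfK// gt_eqF.
lra.
Qed.

Lemma form_cauchy_cvg s : (forall n, D (s n)) -> form_cauchy s ->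
  cvgn (fun n => b (s n) (s n)).
Proof.
move=> Ds /(form_cauchyP _ Ds) Cs.
have /cvg_ex[l ls] : cvgn (fun n => nm (s n)).
  apply: cauchy_seq_cvg => e /Cs[N HN]; exists N => i j Ni Nj.
  by apply: le_lt_trans (seminorm_dist _ _ (Ds i) (Ds j)) _; exact: HN.
apply/cvg_ex; exists (l * l).
under eq_fun do rewrite -sqr_seminorm// expr2.
exact: cvgM.
Qed.

Lemma form_cauchy_cvg2 s s' : (forall n, D (s n)) -> (forall n, D (s' n)) ->
  form_cauchy s -> form_cauchy s' -> cvgn (fun n => b (s n) (s' n)).
Proof.
move=> Ds Ds' Cs Cs'.
(* Polarisation reduces the claim to squares along Cauchy sequences. *)
have -> : (fun n => b (s n) (s' n)) = (fun n => 4^-1 *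
   (b (s n + 1 *: s' n) (s n + 1 *: s' n) -
    b (s n + (-1) *: s' n) (s n + (-1) *: s' n))).
  by apply/funext => n; rewrite !pf_sqrD//; field.
apply: is_cvgMl_tmp; apply: is_cvgB; apply: form_cauchy_cvg.
- by move=> n; apply: pf_domD => //; exact: pf_domZ.
- exact: form_cauchyD.
- by move=> n; apply: pf_domD => //; exact: pf_domZ.
- exact: form_cauchyD.
Qed.

End PsdForm.

(** * Closure and resolvent of a form *)

Section FormLimits.
Context {R : realType} {V : lmodType R} (D : set V) (b : V -> V -> R).
Hypothesis bP : psd_form D b.
Local Notation nm := (seminorm b).
Context {T : Type} {F : set_system T} {FF : ProperFilter F}.

Lemma seminorm_cvg (s t : T -> V) (l : R) : (forall x, D (s x)) ->
  (forall x, D (t x)) -> nm (s x - t x) @[x --> F] --> (0 : R) ->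
  nm (t x) @[x --> F] --> l -> nm (s x) @[x --> F] --> l.
Proof.
move=> Ds Dt st tl.
have : (nm (s x) - nm (t x)) @[x --> F] --> (0 : R).
  apply/cvgr0Pnorm_le => e e0; move/cvgr0Pnorm_le : st => /(_ e e0).
  apply: filterS => x; apply: le_trans.
  rewrite (le_trans (seminorm_dist _ _ bP _ _ (Ds x) (Dt x)))//.
  exact: ler_norm.
move=> /(cvgD tl); rewrite addr0; apply: cvg_trans.
by apply: near_eq_cvg; apply: nearW => x /=; rewrite addrC subrK.
Qed.

(** b(s, s') - b(t, t') = b(s - t, s') + b(t, s' - t'), then Cauchy-Schwarz; the limits k and l
    serve to bound the seminorms. *)
Lemma pf_cvg (s s' t t' : T -> V) (k l L : R) :
  (forall x, D (s x)) -> (forall x, D (s' x)) ->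
  (forall x, D (t x)) -> (forall x, D (t' x)) ->
  nm (s x - t x) @[x --> F] --> (0 : R) ->
  nm (s' x - t' x) @[x --> F] --> (0 : R) ->
  nm (t x) @[x --> F] --> k -> nm (t' x) @[x --> F] --> l ->
  b (t x) (t' x) @[x --> F] --> L -> b (s x) (s' x) @[x --> F] --> L.
Proof.
move=> Ds Ds' Dt Dt' st st' tk tl' ttL.
have sl := seminorm_cvg _ _ _ Ds' Dt' st' tl'.
have : (b (s x - t x) (s' x) + b (t x) (s' x - t' x)) @[x --> F] --> (0 : R).
  apply/norm_cvg0P.
  apply: (@cvgr0_le _ _ _ _ _
    (fun x => nm (s x - t x) * nm (s' x) + nm (t x) * nm (s' x - t' x))).
    apply: nearW => x; rewrite normr_ge0/=.
    have ? := pf_domB _ _ bP _ _ (Ds x) (Dt x).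
    have ? := pf_domB _ _ bP _ _ (Ds' x) (Dt' x).
    by rewrite (le_trans (ler_normD _ _))// lerD// (pf_CauchySchwarz _ _ bP).
  rewrite [X in _ --> X](_ : _ = 0 * l + k * 0); last by rewrite mul0r mulr0 addr0.
  by apply: cvgD; exact: cvgM.
move=> d0; rewrite -[L]addr0.
have -> : (fun x => b (s x) (s' x)) = (fun x => b (t x) (t' x) +
    (b (s x - t x) (s' x) + b (t x) (s' x - t' x))).
  by apply/funext => x; rewrite (pfBl _ _ bP)// (pfBr _ _ bP)//; ring.
exact: cvgD.
Qed.

End FormLimits.

Section Closure.
Context {R : realType} {V : lmodType R} (ip : V -> V -> R).
Hypothesis ipP : psd_form setT ip.
Context (D0 : set V) (q0 : V -> V -> R).
Hypothesis q0P : psd_form D0 q0.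
Local Notation nm := (seminorm ip).

Definition approximates (u : V) (s : nat -> V) :=
  [/\ forall n, D0 (s n), form_cauchy q0 s & nm (s n - u) @[n --> \oo] --> (0 : R)].

Definition closure_dom : set V := [set u | exists s, approximates u s].

Hypothesis q0_closable : forall s, (forall n, D0 (s n)) -> form_cauchy q0 s ->
  nm (s n) @[n --> \oo] --> (0 : R) -> q0 (s n) (s n) @[n --> \oo] --> (0 : R).

Context (q : V -> V -> R).
Hypothesis q_spec : forall u v, closure_dom u -> closure_dom v ->
  exists s s', [/\ approximates u s, approximates v s' &
    q u v = limn (fun n => q0 (s n) (s' n))].

Lemma approximatesD c u v s s' : approximates u s -> approximates v s' ->
  approximates (u + c *: v) (fun n => s n + c *: s' n).
Proof.
move=> [Ds Cs su] [Ds' Cs' sv]; split.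
- by move=> n; apply: (pf_domD _ _ q0P) => //; exact: (pf_domZ _ _ q0P).
- exact: (form_cauchyD _ _ q0P).
- apply: (@cvgr0_le _ _ _ _ _ (fun n => nm (s n - u) + `|c| * nm (s' n - v))).
    apply: nearW => n; rewrite seminorm_ge0/= opprD addrACA -scalerBr.
    by rewrite (le_trans (seminormD _ _ ipP _ _ _ _))// (seminormZ _ _ ipP).
  rewrite [X in _ --> X](_ : _ = 0 + `|c| * 0); last by rewrite mulr0 addr0.
  by apply: cvgD => //; apply: cvgM => //; exact: cvg_cst.
Qed.

(** The difference of the two sequences approximates 0, where closability applies. *)
Lemma approximates_unique u s s' : approximates u s -> approximates u s' ->
  seminorm q0 (s n - s' n) @[n --> \oo] --> (0 : R).
Proof.
move=> us us'; have [D1 C1 L1] := approximatesD (-1) _ _ _ _ us us'.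
move: L1; rewrite scaleN1r subrr; under eq_fun do rewrite subr0.
move=> /(q0_closable _ D1 C1)/cvgr0_sqrt; apply: cvg_trans.
by apply: near_eq_cvg; apply: nearW => n; rewrite scaleN1r.
Qed.

Lemma approximates_cvg_seminorm u s : approximates u s ->
  exists l : R, seminorm q0 (s n) @[n --> \oo] --> l.
Proof.
move=> [Ds Cs _]; have /cvg_ex[l sl] := form_cauchy_cvg _ _ q0P _ Ds Cs.
by exists (Num.sqrt l); apply: (continuous_cvg _ (@sqrt_continuous R l)).
Qed.

(** [q_spec] ties q to one pair of sequences, as a definition by choice does; closability makes the
    limit the same along all pairs. *)
Lemma approximates_form u v s s' : approximates u s -> approximates v s' ->
  q0 (s n) (s' n) @[n --> \oo] --> q u v.
Proof.
move=> us vs'; have := us => -[Ds Cs su]; have := vs' => -[Ds' Cs' sv].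
have [||t [t' [ut vt' ->]]] := q_spec u v; [by exists s|by exists s'|].
have [k tk] := approximates_cvg_seminorm _ _ ut.
have [l tl] := approximates_cvg_seminorm _ _ vt'.
have [Dt Ct _] := ut; have [Dt' Ct' _] := vt'.
apply: (pf_cvg _ _ q0P s s' t t' k l) => //.
- exact: approximates_unique us ut.
- exact: approximates_unique vs' vt'.
- exact: (form_cauchy_cvg2 _ _ q0P).
Qed.

Lemma approximates0 : approximates 0 (fun=> 0).
Proof.
have D00 := pf_dom0 _ _ q0P; split => // [e e0|].
  by exists 0%N => i j _ _; rewrite subrr (pf0l _ _ q0P).
rewrite subrr /seminorm (pf0l _ _ ipP)// sqrtr0; exact: cvg_cst.
Qed.

Lemma core_sub_closure : D0 `<=` closure_dom.
Proof.
move=> u Du; have D00 := pf_dom0 _ _ q0P; exists (fun=> u); split => // [e e0|].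
  by exists 0%N => i j _ _; rewrite subrr (pf0l _ _ q0P).
rewrite subrr /seminorm (pf0l _ _ ipP)// sqrtr0; exact: cvg_cst.
Qed.

Lemma closure_psd_form : psd_form closure_dom q.
Proof.
split.
- by exists (fun=> 0); exact: approximates0.
- move=> c u v [s us] [s' vs']; rewrite addrC.
  by exists (fun n => s' n + c *: s n); exact: approximatesD.
- move=> c u v w [s us] [s' vs'] [r wr]; rewrite addrC.
  have := approximates_form _ _ _ _ (approximatesD c _ _ _ _ vs' us) wr.
  move/(cvg_unique _); apply => //.
  have -> : (fun n => q0 (s' n + c *: s n) (r n)) =
            (fun n => c * q0 (s n) (r n) + q0 (s' n) (r n)).
    apply/funext => n; have [Ds _ _] := us; have [Ds' _ _] := vs'.
    have [Dr _ _] := wr.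
    by rewrite addrC (pf_linear _ _ q0P).
  apply: cvgD; last exact: approximates_form.
  by apply: cvgM; [exact: cvg_cst|exact: approximates_form].
- move=> u v [s us] [s' vs'].
  have := approximates_form _ _ _ _ us vs'.
  move/(cvg_unique _); apply => //.
  have -> : (fun n => q0 (s n) (s' n)) = (fun n => q0 (s' n) (s n)).
    apply/funext => n; have [Ds _ _] := us; have [Ds' _ _] := vs'.
    by rewrite (pf_sym _ _ q0P).
  exact: approximates_form.
- move=> u [s us]; have := approximates_form _ _ _ _ us us.
  move=> sq; rewrite -(cvg_lim _ sq)//; apply: limr_ge.
    by apply/cvg_ex; exists (q u u).
  by apply: nearW => n; have [Ds _ _] := us; exact: (pf_ge0 _ _ q0P).
Qed.

Hypothesis ip_complete : forall s, form_cauchy ip s ->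
  exists u, nm (s n - u) @[n --> \oo] --> (0 : R).

Lemma shifted_psd_form (h : R) : 0 < h ->
  psd_form D0 (fun u v => h * q0 u v + ip u v).
Proof.
move=> h0; split.
- exact: (pf_dom0 _ _ q0P).
- exact: (pf_domP _ _ q0P).
- move=> c u v w Du Dv Dw.
  by rewrite (pf_linear _ _ q0P)// (pf_linear _ _ ipP)//; ring.
- by move=> u v Du Dv; rewrite (pf_sym _ _ q0P)// (pf_sym _ _ ipP).
- by move=> u Du; rewrite addr_ge0 ?mulr_ge0 ?(pf_ge0 _ _ q0P) ?(pf_ge0 _ _ ipP)// ltW.
Qed.

(* A minimising sequence s_n of J(s) = h q0(s, s) + |s|^2 - 2 (f, s) satisfies
   the Euler-Lagrange equation up to an error controlled by J(s_n) - inf J,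
   which makes it Cauchy and identifies the equation of its limit. *)
Lemma resolvent_exists (C : set V) (h : R) (f : V) : 0 < h ->
  (forall s u, (forall n, C (s n)) -> nm (s n - u) @[n --> \oo] --> (0 : R) -> C u) ->
  (C f -> forall s, D0 s -> exists s', [/\ D0 s', C s', q0 s' s' <= q0 s s,
     ip s' s' = ip s s & ip f s <= ip f s']) ->
  exists u, [/\ closure_dom u, C f -> C u &
    forall w, closure_dom w -> h * q u w + ip u w = ip f w].
Proof.
move=> h0 C_closed C_proj.
pose B u v := h * q0 u v + ip u v.
have BP : psd_form D0 B := shifted_psd_form _ h0.
pose J s := B s s - 2 * ip f s.
have JD s c w : D0 s -> D0 w ->
    J (s + c *: w) = J s + 2 * c * (B s w - ip f w) + c ^+ 2 * B w w.
  move=> Ds Dw; rewrite /J (pf_sqrD _ _ BP)// (pfDr _ _ ipP)// (pfZr _ _ ipP)//.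
  ring.
(* Completing the square: |s - f|^2 >= 0. *)
have J_ge s : D0 s -> - ip f f <= J s.
  move=> Ds; have := pf_ge0 _ _ q0P _ Ds => q0s.
  have := pf_ge0 _ _ ipP (s - f) I; rewrite (pf_sqrB _ _ ipP)// => ips.
  rewrite /J /B (pf_sym _ _ ipP f)//.
  have := mulr_ge0 (ltW h0) q0s; lra.
pose I := inf [set J s | s in D0].
have hI : has_inf [set J s | s in D0].
  split; first by exists (J 0), 0 => //; exact: (pf_dom0 _ _ q0P).
  by exists (- ip f f) => _ [s Ds <-]; exact: J_ge.
have I_le s : D0 s -> I <= J s.
  by move=> Ds; apply: ge_inf => //; [case: hI|exists s].
pose d n : R := n.+1%:R^-1.
have d0 n : 0 < d n by rewrite /d invr_gt0.
have /choice[s Hs] : forall n : nat,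
    exists x, [/\ D0 x, J x <= I + d n & C f -> C x].
  move=> n.
  have [_ [x Dx <-] /ltW xI] := inf_adherent (d0 n) hI.
  have [Cf|nCf] := pselect (C f); last by exists x.
  (* Passing to x' does not increase J: q0 does not grow, the norm is kept, and (f, x') >= (f,
     x). *)
  have [x' [Dx' Cx' qx' nx' fx']] := C_proj Cf _ Dx.
  exists x'; split => //; apply: le_trans xI.
  by rewrite /J /B nx'; have := ler_wpM2l (ltW h0) qx'; lra.
have Ds n : D0 (s n) by case: (Hs n).
(* J(s_n + c w) >= I >= J(s_n) - d_n for every c is a non-negative quadratic in c with constant term
   d_n; take its discriminant. *)
have EL n w : D0 w -> `|B (s n) w - ip f w| <= Num.sqrt (d n) * seminorm B w.
  move=> Dw; rewrite -[leLHS]sqrtr_sqr -sqrtrM ?(ltW (d0 n))//.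
  rewrite ler_wsqrtr// quad_ge0_discr ?(pf_ge0 _ _ BP)// => c.
  have [_ Js _] := Hs n.
  have := I_le (s n + c *: w).
  rewrite JD// => /(_ (pf_domD _ _ q0P _ _ (Ds n) (pf_domZ _ _ q0P c _ Dw))).
  lra.
have sd0 : Num.sqrt (d n) @[n --> \oo] --> (0 : R).
  by apply: cvgr0_sqrt; exact: cvg_harmonic.
have BC : form_cauchy B s.
  apply/(form_cauchyP _ _ BP) => // e e0.
  move/cvgr0Pnorm_lt : sd0 => /(_ (e / 2) ltac:(lra))[N _ HN].
  exists N => i j Ni Nj.
  have Dij := pf_domB _ _ BP _ _ (Ds i) (Ds j).
  (* Subtracting the approximate equations for s_i and s_j, tested with s_i - s_j, eliminates f. *)
  have H : seminorm B (s i - s j) ^+ 2 <=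
      (Num.sqrt (d i) + Num.sqrt (d j)) * seminorm B (s i - s j).
    rewrite (sqr_seminorm _ _ BP)// {1}(pfBl _ _ BP)//.
    have := EL i _ Dij; have := EL j _ Dij.
    by rewrite !ler_norml => /andP[h1 h2] /andP[h3 h4]; lra.
  have : seminorm B (s i - s j) <= Num.sqrt (d i) + Num.sqrt (d j).
    have [->|B0] := eqVneq (seminorm B (s i - s j)) 0.
      by rewrite addr_ge0// sqrtr_ge0.
    by rewrite -(@ler_pM2r _ (seminorm B (s i - s j))) ?lt0r ?B0 ?seminorm_ge0// -expr2.
  have := HN _ Ni; have := HN _ Nj; rewrite /= !ger0_norm ?sqrtr_ge0//; lra.
have [u su] : exists u, nm (s n - u) @[n --> \oo] --> (0 : R).
  apply: ip_complete => e /BC[N HN]; exists N => i j Ni Nj.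
  apply: le_lt_trans (HN i j Ni Nj); rewrite /B lerDr mulr_ge0 ?(ltW h0)//.
  by apply: (pf_ge0 _ _ q0P); exact: (pf_domB _ _ q0P).
have us : approximates u s.
  split => // e e0; have [N HN] := BC _ (mulr_gt0 h0 e0).
  exists N => i j Ni Nj; rewrite -(ltr_pM2l h0).
  apply: le_lt_trans (HN i j Ni Nj); rewrite /B lerDl.
  exact: (pf_ge0 _ _ ipP).
exists u; split; first by exists s.
  by move=> Cf; apply: C_closed su => n; have [_ _] := Hs n; exact.
(* The test vector w is approximated by w'_n in the core, where [EL] applies; the B-seminorm of w'_n
   stays bounded, so the error vanishes. *)
move=> w [w' ww']; have [Dw Cw wl] := ww'.
have ipc x : ip x (w' n) @[n --> \oo] --> ip x w.
  apply: (pf_cvg _ _ ipP _ _ (fun=> x) (fun=> w) (nm x) (nm w)) => //; try exact: cvg_cst.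
  by rewrite subrr /seminorm (pf0l _ _ ipP)// sqrtr0; exact: cvg_cst.
have ipsw : ip (s n) (w' n) @[n --> \oo] --> ip u w.
  by apply: (pf_cvg _ _ ipP _ _ (fun=> u) (fun=> w) (nm u) (nm w)) => //; exact: cvg_cst.
have Bsw : (B (s n) (w' n) - ip f (w' n)) @[n --> \oo] -->
    h * q u w + ip u w - ip f w.
  apply: cvgB => //; apply: cvgD => //; apply: cvgM; first exact: cvg_cst.
  exact: approximates_form.
have : (B (s n) (w' n) - ip f (w' n)) @[n --> \oo] --> (0 : R).
  have [l wl'] : exists l : R, seminorm B (w' n) @[n --> \oo] --> l.
    exists (Num.sqrt (h * q w w + ip w w)).
    apply: (continuous_cvg _ (@sqrt_continuous R _)); apply: cvgD.
      by apply: cvgM; [exact: cvg_cst|exact: approximates_form].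
    by apply: (pf_cvg _ _ ipP _ _ (fun=> w) (fun=> w) (nm w) (nm w)) => //; exact: cvg_cst.
  apply/norm_cvg0P.
  apply: (@cvgr0_le _ _ _ _ _ (fun n => Num.sqrt (d n) * seminorm B (w' n))).
    by apply: nearW => n; rewrite normr_ge0/= EL.
  by rewrite -[X in _ --> X](mul0r l); exact: cvgM.
move/(cvg_unique _ Bsw) => /(_ (@norm_hausdorff _ _))/eqP.
by rewrite subr_eq0 => /eqP.
Qed.

End Closure.

(** * Semigroups *)

Section Semigroup.
Context {R : realType} {V : lmodType R} (ip : V -> V -> R).
Hypothesis ipP : psd_form setT ip.
Context (D : set V) (q : V -> V -> R).
Hypothesis qP : psd_form D q.
Local Notation nm := (seminorm ip).
Hypothesis D_dense : forall x (e : R), 0 < e -> exists2 y, D y & nm (x - y) < e.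

Context (T : R -> V -> V).
Hypothesis T_linear : forall (t c : R) f g, 0 < t ->
  nm (T t (c *: f + g) - (c *: T t f + T t g)) = 0.
Hypothesis T_contraction : forall t f, 0 < t -> nm (T t f) <= nm f.
Hypothesis T_sym : forall t f g, 0 < t -> ip (T t f) g = ip f (T t g).
Hypothesis T_add : forall t r f, 0 < t -> 0 < r ->
  nm (T (t + r) f - T t (T r f)) = 0.

Definition in_generator u g := D u /\ forall v, D v -> q u v = - ip g v.

Hypothesis T_generator : forall u g,
  nm (t^-1 *: (T t u - u) - g) @[t --> 0^'+] --> (0 : R) <-> in_generator u g.

Context (C : set V) (Rs : R -> V -> V).
Hypothesis C_closed : forall s u, (forall n : nat, C (s n)) ->
  nm (s n - u) @[n --> \oo] --> (0 : R) -> C u.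
Hypothesis Rs_dom : forall h f, 0 < h -> D (Rs h f).
Hypothesis Rs_cone : forall h f, 0 < h -> C f -> C (Rs h f).
Hypothesis Rs_eq : forall h f w, 0 < h -> D w ->
  h * q (Rs h f) w + ip (Rs h f) w = ip f w.

(** (x, x) = (y, x) = (x, y) = (y, y). Identities known only inside inner products become identities
    of norms this way. *)
Lemma seminorm_ext x y : (forall w, ip x w = ip y w) -> nm x = nm y.
Proof. by move=> xy; rewrite /seminorm xy (pf_sym _ _ ipP)// xy. Qed.

(** * Estimates for the resolvent *)

Lemma Rs_contraction h f : 0 < h -> nm (Rs h f) <= nm f.
Proof.
move=> h0; have Du := Rs_dom h f h0.
have := Rs_eq h f _ h0 Du; have := pf_ge0 _ _ qP _ Du => qu.
have := mulr_ge0 (ltW h0) qu => hq.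
have := pf_le _ _ ipP f (Rs h f) I I => fu.
rewrite -(sqr_seminorm _ _ ipP)// => e.
have [->|u0] := eqVneq (nm (Rs h f)) 0; first exact: seminorm_ge0.
rewrite -(@ler_pM2r _ (nm (Rs h f))) ?lt0r ?u0 ?seminorm_ge0//.
by rewrite -expr2; lra.
Qed.

(** The difference of two solutions, tested with itself, has norm zero because q is non-negative.
    [Rs_sub], [T_Rs_commute] and [Rs_expand] rest on this. *)
Lemma Rs_unique h f u : 0 < h -> D u ->
  (forall w, D w -> h * q u w + ip u w = ip f w) -> nm (u - Rs h f) = 0.
Proof.
move=> h0 Du Hu; have Dr := Rs_dom h f h0.
have Dd := pf_domB _ _ qP _ _ Du Dr.
have e1 := Hu _ Dd; have e2 := Rs_eq h f _ h0 Dd.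
have := pf_ge0 _ _ qP _ Dd; rewrite (pfBl _ _ qP)// => q1.
have := mulr_ge0 (ltW h0) q1 => q2.
have : ip (u - Rs h f) (u - Rs h f) <= 0.
  by rewrite {1}(pfBl _ _ ipP)//; lra.
move=> le0; apply/eqP; rewrite /seminorm sqrtr_eq0 //.
Qed.

Lemma Rs_sub h f g : 0 < h -> nm (Rs h f - Rs h g - Rs h (f - g)) = 0.
Proof.
move=> h0; apply: Rs_unique => //; first by apply: (pf_domB _ _ qP); exact: Rs_dom.
move=> w Dw; rewrite (pfBl _ _ qP) ?(pfBl _ _ ipP)//; try exact: Rs_dom.
by rewrite -(Rs_eq h f w)// -(Rs_eq h g w)//; ring.
Qed.

Lemma seminorm_null x y : nm (x - y) = 0 -> nm x = nm y.
Proof.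
move=> xy; apply/eqP; rewrite -subr_eq0 -normr_le0 -xy.
exact: (seminorm_dist _ _ ipP).
Qed.

Lemma Rs_lipschitz h f g : 0 < h -> nm (Rs h f - Rs h g) <= nm (f - g).
Proof. by move=> h0; rewrite (seminorm_null _ _ (Rs_sub h f g h0)) Rs_contraction. Qed.

(** With u = [Rs h f], testing with f and with u gives |f - u|^2 = h q(u, f) - h q(u, u) and (f - u,
    u) = h q(u, u); conclude by q(u - f, u - f) >= 0 and |f - u|^2 >= 0. *)
Lemma Rs_energy h f : 0 < h -> D f ->
  nm (f - Rs h f) ^+ 2 <= h * q f f /\ ip (f - Rs h f) (Rs h f) <= h * q f f.
Proof.
move=> h0 Df; have Du := Rs_dom h f h0; rewrite (sqr_seminorm _ _ ipP)//.
have e1 := Rs_eq h f _ h0 Df; have e2 := Rs_eq h f _ h0 Du.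
have := pf_ge0 _ _ qP _ (pf_domB _ _ qP _ _ Du Df); rewrite (pf_sqrB _ _ qP)// => q1.
have := mulr_ge0 (ltW h0) q1 => {}q1.
have := pf_ge0 _ _ ipP (f - Rs h f) I => n1.
have := mulr_ge0 (ltW h0) (pf_ge0 _ _ qP _ Du) => q2.
rewrite (pf_sqrB _ _ ipP)// in n1 *; rewrite (pfBl _ _ ipP)//.
have s := pf_sym _ _ ipP f (Rs h f) I I; split; lra.
Qed.

Lemma Rs_generator h f : 0 < h -> in_generator (Rs h f) (h^-1 *: (Rs h f - f)).
Proof.
move=> h0; split; first exact: Rs_dom.
move=> v Dv; rewrite (pfZl _ _ ipP)// (pfBl _ _ ipP)// -(Rs_eq h f v)//.
by field; rewrite gt_eqF.
Qed.

(** For y in D, [Rs_energy] gives |[Rs h y] - y|^2 <= h q(y, y); density of D and the contraction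
    property do the rest. *)
Lemma Rs_cvg x : nm (Rs h x - x) @[h --> 0^'+] --> (0 : R).
Proof.
apply/cvgr0Pnorm_lt => e e0.
have e3 : 0 < e / 3 by lra.
have [y Dy xy] := D_dense x _ e3.
have : Num.sqrt (h * q y y) @[h --> 0^'+] --> (0 : R).
  apply: cvgr0_sqrt; rewrite -[X in _ --> X](mul0r (q y y)).
  apply: cvgM; last exact: cvg_cst.
  by apply: cvg_at_right_filter; exact: cvg_id.
move/cvgr0Pnorm_lt => /(_ _ e3) H.
near=> h.
have h0 : 0 < h by [].
have : `|Num.sqrt (h * q y y)| < e / 3 by near: h.
rewrite !ger0_norm ?seminorm_ge0 ?sqrtr_ge0// => hq.
have t1 := seminorm_trans _ _ ipP (Rs h y) (Rs h x) x I I I.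
have t2 := seminorm_trans _ _ ipP y (Rs h y) x I I I.
have t3 := Rs_lipschitz h x y h0.
have [t4 _] := Rs_energy h y h0 Dy.
have t5 := seminorm_distC _ _ ipP x y I I.
have : nm (Rs h y - y) <= Num.sqrt (h * q y y).
  rewrite (seminorm_distC _ _ ipP)// -(ger0_norm (seminorm_ge0 _ _)) -sqrtr_sqr.
  exact: ler_wsqrtr.
lra.
Unshelve. all: by end_near. Qed.

(** * The semigroup as a limit of resolvent powers *)

Lemma ipT_linear t c f g w : 0 < t ->
  ip (T t (c *: f + g)) w = c * ip (T t f) w + ip (T t g) w.
Proof.
move=> t0; rewrite (pf_null_sub _ _ ipP _ _ w I I I (T_linear t c f g t0)).
by rewrite (pf_linear _ _ ipP).
Qed.

Lemma ipTB t f g w : 0 < t -> ip (T t (f - g)) w = ip (T t f) w - ip (T t g) w.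
Proof. by move=> t0; rewrite addrC -scaleN1r ipT_linear//; ring. Qed.

Lemma ipTZ t c f w : 0 < t -> ip (T t (c *: f)) w = c * ip (T t f) w.
Proof.
move=> t0; have := ipTB t 0 0 w t0; rewrite !subrr => T0.
by rewrite -[_ *: f]addr0 ipT_linear// T0 addr0.
Qed.

Lemma ipT_add t r f w : 0 < t -> 0 < r ->
  ip (T (t + r) f) w = ip (T t (T r f)) w.
Proof. by move=> t0 r0; exact: (pf_null_sub _ _ ipP _ _ w I I I (T_add t r f t0 r0)). Qed.

Lemma T_lipschitz t f g : 0 < t -> nm (T t f - T t g) <= nm (f - g).
Proof.
move=> t0; rewrite (seminorm_ext _ (T t (f - g))) ?T_contraction// => w.
by rewrite ipTB// (pfBl _ _ ipP).
Qed.

(** T_s commutes with the difference quotients of the semigroup and, being a contraction, carries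
    their limit along. *)
Lemma generatorT s u g : 0 < s -> in_generator u g -> in_generator (T s u) (T s g).
Proof.
move=> s0 /T_generator H; apply/T_generator; apply: cvgr0_le H.
near=> t.
have t0 : 0 < t by [].
rewrite seminorm_ge0/= -(seminorm_ext (T s (t^-1 *: (T t u - u) - g))).
  exact: T_contraction.
move=> w; rewrite ipTB// ipTZ// ipTB// -ipT_add// [s + t]addrC ipT_add//.
by rewrite (pfBl _ _ ipP)// (pfZl _ _ ipP)// (pfBl _ _ ipP).
Unshelve. all: by end_near. Qed.

Lemma T_Rs_commute s h f : 0 < s -> 0 < h ->
  nm (T s (Rs h f) - Rs h (T s f)) = 0.
Proof.
move=> s0 h0; have [DT qT] := generatorT _ _ _ s0 (Rs_generator h f h0).
apply: Rs_unique => // w Dw.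
by rewrite qT// ipTZ// ipTB//; field; rewrite gt_eqF.
Qed.

(** With G the generator: (1 - h G)^-1 f = f + h (1 - h G)^-1 G f. *)
Lemma Rs_expand h f g : 0 < h -> in_generator f g ->
  nm (f + h *: Rs h g - Rs h f) = 0.
Proof.
move=> h0 [Df qf]; have Dw := Rs_dom h g h0; have Dhw := pf_domZ _ _ qP h _ Dw.
apply: Rs_unique => //; first exact: (pf_domD _ _ qP).
move=> v Dv; rewrite (pfDl _ _ qP)// (pfDl _ _ ipP)// (pfZl _ _ qP)// (pfZl _ _ ipP)//.
by rewrite qf// -(Rs_eq h g v)//; ring.
Qed.

(** Both T_h f and [Rs h f] have the first-order expansion f + h g, so the one-step error is o(h) on
    the domain of the generator. *)
Lemma T_Rs_step h f g : 0 < h -> in_generator f g ->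
  nm (T h f - Rs h f) <=
  h * (nm (h^-1 *: (T h f - f) - g) + nm (Rs h g - g)).
Proof.
move=> h0 fg.
rewrite (seminorm_ext _
    (h *: ((h^-1 *: (T h f - f) - g) - (Rs h g - g)))) => [|w].
  rewrite (seminormZ _ _ ipP)// gtr0_norm// ler_pM2l//.
  exact: (seminormB _ _ ipP).
rewrite (pfBl _ _ ipP)// -(pf_null_sub _ _ ipP _ _ w I I I (Rs_expand _ _ _ h0 fg)).
rewrite (pfDl _ _ ipP)// !((pfZl _ _ ipP), (pfBl _ _ ipP))//.
by field; rewrite gt_eqF.
Qed.

(** Telescoping: each one-step error is propagated by commuting contractions. The count starts at
    one step since only T_t with t > 0 is at hand. *)
Lemma T_Rs_iter n h f : 0 < h ->
  nm (T (n.+1%:R * h) f - iter n.+1 (Rs h) f) <= n.+1%:R * nm (T h f - Rs h f).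
Proof.
move=> h0; elim: n => [|n IH]; first by rewrite !mul1r.
set s := n.+1%:R * h in IH *; have s0 : 0 < s by rewrite mulr_gt0.
have -> : n.+2%:R * h = h + s by rewrite /s -[n.+2]addn1 natrD mulrDl mul1r addrC.
rewrite iterS; set p := iter _ _ _ in IH *.
have t1 := seminorm_trans _ _ ipP (Rs h (T s f)) (T (h + s) f) (Rs h p) I I I.
have t2 := Rs_lipschitz h (T s f) p h0.
have t3 : nm (T (h + s) f - Rs h (T s f)) <= nm (T h f - Rs h f).
  rewrite (seminorm_ext _ (T s (T h f) - T s (Rs h f))); first exact: T_lipschitz.
  move=> w; rewrite !(pfBl _ _ ipP)// -(ipT_add s h)// [s + h]addrC.
  by rewrite (pf_null_sub _ _ ipP _ _ w I I I (T_Rs_commute _ _ f s0 h0)).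
rewrite -[n.+2]addn1 natrD mulrDl mul1r; lra.
Qed.

(** With n.+1 steps of length t / n.+1, the o(h) errors of [T_Rs_step] add up to t times a vanishing
    quantity. *)
Lemma T_cone_generator t f g : 0 < t -> in_generator f g -> C f -> C (T t f).
Proof.
move=> t0 fg Cf.
pose h n : R := t / n.+1%:R.
have h0 n : 0 < h n by rewrite divr_gt0.
have h_cvg : h n @[n --> \oo] --> (0 : R).
  rewrite -[X in _ --> X](mulr0 t); apply: cvgM; first exact: cvg_cst.
  exact: cvg_harmonic.
apply: (C_closed (fun n => iter n.+1 (Rs (h n)) f)) => [n|].
  by elim: n.+1 => //= k; exact: Rs_cone.
have H1 := (T_generator _ _).2 fg; have H2 := Rs_cvg g.
have K1 := (cvg_at_rightP _ _ _).1 H1 h (conj h0 h_cvg).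
have K2 := (cvg_at_rightP _ _ _).1 H2 h (conj h0 h_cvg).
have : (t * (nm ((h n)^-1 *: (T (h n) f - f) - g) + nm (Rs (h n) g - g)))
    @[n --> \oo] --> (0 : R).
  rewrite -[X in _ --> X](mulr0 t); apply: cvgM; first exact: cvg_cst.
  by rewrite -[X in _ --> X](addr0 0); exact: cvgD.
apply: cvgr0_le; apply: nearW => n; rewrite seminorm_ge0/=.
rewrite (seminorm_distC _ _ ipP)//.
have := T_Rs_iter n (h n) f (h0 n).
have hn : n.+1%:R * h n = t by rewrite /h mulrC divfK.
rewrite hn => /le_trans; apply.
rewrite -[t in leRHS]hn -mulrA ler_pM2l ?ltr0Sn//.
exact: T_Rs_step.
Qed.

(* T_t is the limit of the iterates of the resolvent, which preserve C. *)
Lemma T_cone t f : 0 < t -> C f -> C (T t f).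
Proof.
move=> t0 Cf.
pose h n : R := n.+1%:R^-1.
have h0 n : 0 < h n by rewrite invr_gt0.
have h_cvg : h n @[n --> \oo] --> (0 : R) by exact: cvg_harmonic.
(* [Rs (h n) f] is in C and in the domain of the generator, and tends to f. *)
apply: (C_closed (fun n => T t (Rs (h n) f))) => [n|].
  apply: (T_cone_generator _ _ ((h n)^-1 *: (Rs (h n) f - f))) => //.
    exact: Rs_generator.
  exact: Rs_cone.
have := (cvg_at_rightP _ _ _).1 (Rs_cvg f) h (conj h0 h_cvg).
apply: cvgr0_le; apply: nearW => n; rewrite seminorm_ge0/=.
exact: T_lipschitz.
Qed.

(** Expand |T_a u - T_b u|^2 >= 0; by symmetry and the semigroup law each term is a value of s |->
    (T_s u, u). *)
Lemma ipT_convex a b u : 0 < a -> 0 < b ->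
  2 * ip (T (a + b) u) u <= ip (T (a + a) u) u + ip (T (b + b) u) u.
Proof.
move=> a0 b0; rewrite !ipT_add//.
rewrite (T_sym a (T b u))// (T_sym a (T a u))// (T_sym b (T b u))//.
have := pf_ge0 _ _ ipP (T a u - T b u) I; rewrite (pf_sqrB _ _ ipP)//.
by rewrite (pf_sym _ _ ipP (T a u) (T b u))//; lra.
Qed.

(** The endpoint a = 0 of [ipT_convex], with the identity in place of T_0. *)
Lemma ipT_convex0 b u : 0 < b -> 2 * ip (T b u) u <= ip u u + ip (T (b + b) u) u.
Proof.
move=> b0; rewrite ipT_add// (T_sym _ (T b u))//.
have := pf_ge0 _ _ ipP (u - T b u) I; rewrite (pf_sqrB _ _ ipP)//.
by rewrite (pf_sym _ _ ipP (T b u) u)//; lra.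
Qed.

(** A convex sequence has its largest decrement at the start; the induction carries this comparison
    along. *)
Lemma ipT_decrement n h u : 0 < h ->
  ip u u - ip (T (n.+1%:R * h) u) u <= n.+1%:R * (ip u u - ip (T h u) u).
Proof.
move=> h0.
suff : forall n, ip (T (n.+1%:R * h) u) u - ip (T (n.+2%:R * h) u) u <=
         ip u u - ip (T h u) u /\
         ip u u - ip (T (n.+1%:R * h) u) u <= n.+1%:R * (ip u u - ip (T h u) u).
  by move=> /(_ n)[].
elim=> [|k [IH1 IH2]].
  have -> : 2 * h = h + h by lra.
  by rewrite !mul1r; split => //; have := ipT_convex0 h u h0; lra.
have h2 : 0 < h / 2 by lra.
(* Multiples of h / 2, so that a + a, a + b and b + b are k + 1, k + 2 and k + 3 times h. *)
have := ipT_convex (k.+1%:R * (h / 2)) (k.+3%:R * (h / 2)) u.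
rewrite !mulr_gt0// => /(_ isT isT).
have -> : k.+1%:R * (h / 2) + k.+1%:R * (h / 2) = k.+1%:R * h by lra.
have -> : k.+3%:R * (h / 2) + k.+3%:R * (h / 2) = k.+3%:R * h by lra.
have -> : k.+1%:R * (h / 2) + k.+3%:R * (h / 2) = k.+2%:R * h.
  have -> : k.+3%:R = k.+2%:R + 1 :> R by rewrite natr1.
  have -> : k.+2%:R = k.+1%:R + 1 :> R by rewrite natr1.
  lra.
move=> c; split; first by lra.
have -> : k.+2%:R * (ip u u - ip (T h u) u) =
    k.+1%:R * (ip u u - ip (T h u) u) + (ip u u - ip (T h u) u).
  by rewrite -[k.+2%:R]natr1 mulrDl mul1r.
lra.
Qed.

(** Cut t into n.+1 steps: [ipT_decrement] bounds the decrement by t times the first difference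
    quotient, which tends to - (g, u). *)
Lemma generator_decrement t u g : 0 < t -> in_generator u g ->
  ip (u - T t u) u <= t * - ip g u.
Proof.
move=> t0 ug.
pose h n : R := t / n.+1%:R.
have h0 n : 0 < h n by rewrite divr_gt0.
have h_cvg : h n @[n --> \oo] --> (0 : R).
  rewrite -[X in _ --> X](mulr0 t); apply: cvgM; first exact: cvg_cst.
  exact: cvg_harmonic.
have H := (cvg_at_rightP _ _ _).1 ((T_generator _ _).2 ug) h (conj h0 h_cvg).
have : t * (- ip g u + nm ((h n)^-1 *: (T (h n) u - u) - g) * nm u)
     @[n --> \oo] --> t * (- ip g u + 0 * nm u).
  apply: cvgM; first exact: cvg_cst.
  apply: cvgD; first exact: cvg_cst.
  by apply: cvgM => //; exact: cvg_cst.
rewrite mul0r addr0 => K.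
rewrite -(cvg_lim _ K)//; apply: limr_ge; first by apply/cvg_ex; eexists; exact: K.
apply: nearW => n.
have := ipT_decrement n (h n) u (h0 n).
have hn : n.+1%:R * h n = t by rewrite /h mulrC divfK.
rewrite hn (pfBl _ _ ipP)// => /le_trans; apply.
have -> : n.+1%:R = t / h n by rewrite -{1}hn mulfK// gt_eqF.
rewrite -mulrA ler_pM2l//.
have := pf_le _ _ ipP (- ((h n)^-1 *: (T (h n) u - u) - g)) u I I.
rewrite (seminormN _ _ ipP)// => /(le_trans _)le.
rewrite -lerBlDl; apply: le.
rewrite -scaleN1r !((pfZl _ _ ipP), (pfBl _ _ ipP))//; lra.
Qed.

(** [generator_decrement] gives the bound for [Rs h f]; it passes to f as h tends to 0, the distance
    being at most the square root of h q(f, f). *)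
Lemma form_decrement t f : 0 < t -> D f -> ip (f - T t f) f <= t * q f f.
Proof.
move=> t0 Df.
pose B x y := ip (x - T t x) y.
have BE x y z : B (x - y) z = B x z - B y z.
  by rewrite /B !(pfBl _ _ ipP)// ipTB//; ring.
have Ble x y : B x y <= 2 * nm x * nm y.
  apply: le_trans (pf_le _ _ ipP _ _ I I) _.
  rewrite ler_wpM2r ?seminorm_ge0//.
  apply: le_trans (seminormB _ _ ipP _ _ I I) _.
  by have := T_contraction t x t0; lra.
have key h : 0 < h -> B f f <= t * q f f + 4 * nm f * Num.sqrt (h * q f f).
  move=> h0; set u := Rs h f.
  have [e1 e2] := Rs_energy h f h0 Df.
  have := generator_decrement t u _ t0 (Rs_generator h f h0).
  rewrite (pfZl _ _ ipP)// => g1.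
  have g2 : B u u <= t * q f f.
    apply: le_trans g1 _; rewrite ler_pM2l//.
    rewrite -mulrN mulrC ler_pdivrMr// mulrC.
    by move: e2; rewrite !(pfBl _ _ ipP)//; lra.
  have nf : nm (f - u) <= Num.sqrt (h * q f f).
    by rewrite -(ger0_norm (seminorm_ge0 _ _)) -sqrtr_sqr ler_wsqrtr.
  have nu := Rs_contraction h f h0.
  (* Each of the last two terms has a factor f - u and is bounded with the constant 2 of [Ble],
     whence the 4. *)
  have -> : B f f = B u u + B (f - u) f + B u (f - u).
    by rewrite BE {5}/B (pfBr _ _ ipP)// -!/(B _ _); ring.
  have b1 := Ble (f - u) f; have b2 := Ble u (f - u).
  have n0 := seminorm_ge0 ip (f - u); have n1 := seminorm_ge0 ip f.
  have c1 : nm u * nm (f - u) <= nm f * nm (f - u) by rewrite ler_wpM2r.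
  have c2 : nm f * nm (f - u) <= nm f * Num.sqrt (h * q f f) by rewrite ler_wpM2l.
  lra.
pose h n : R := n.+1%:R^-1.
have : t * q f f + 4 * nm f * Num.sqrt (h n * q f f) @[n --> \oo] -->
    t * q f f + 4 * nm f * 0.
  apply: cvgD; first exact: cvg_cst.
  apply: cvgM; first exact: cvg_cst.
  apply: cvgr0_sqrt; rewrite -[X in _ --> X](mul0r (q f f)).
  by apply: cvgM; [exact: cvg_harmonic|exact: cvg_cst].
rewrite mulr0 addr0 => K.
rewrite -(cvg_lim _ K)//; apply: limr_ge; first by apply/cvg_ex; eexists; exact: K.
by apply: nearW => n; apply: key; rewrite /h invr_gt0.
Qed.

(* (v, T_t v) - |T_t v|^2 = |T_(t/2) v|^2 - |T_(t/2) T_(t/2) v|^2 >= 0 *)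
Lemma sqr_decrement t v : 0 < t -> nm (v - T t v) ^+ 2 <= ip (v - T t v) v.
Proof.
move=> t0; have t2 : 0 < t / 2 by lra.
have tE : t = t / 2 + t / 2 by lra.
rewrite (sqr_seminorm _ _ ipP)// (pf_sqrB _ _ ipP)// (pfBl _ _ ipP)//.
rewrite (pf_sym _ _ ipP v)//.
have a1 : ip (T t v) v = nm (T (t / 2) v) ^+ 2.
  by rewrite (sqr_seminorm _ _ ipP)// {1}tE ipT_add// T_sym.
have a2 : ip (T t v) (T t v) = nm (T (t / 2) (T (t / 2) v)) ^+ 2.
  rewrite -(sqr_seminorm _ _ ipP)//; congr (_ ^+ 2).
  by apply: seminorm_ext => w; rewrite {1}tE ipT_add.
have : nm (T (t / 2) (T (t / 2) v)) ^+ 2 <= nm (T (t / 2) v) ^+ 2.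
  by rewrite ler_pXn2r// ?nnegrE ?seminorm_ge0// T_contraction.
lra.
Qed.

End Semigroup.

(** * The space L^2 *)

Section SquareIntegrable.
Context {R : realType} {E : pmetricType R}.
Variable m : {measure set (borel E) -> \bar R}.
Local Notation L2T := (LfunType m (lee1n 2)).
Local Notation ip := (ip m).

(** [L2T] consists of functions, so this product is definite only modulo a.e. equality. *)
Definition ipL (f g : L2T) : R := ip f g.
Local Notation nm := (seminorm ipL).

Lemma L2_measurable f : L2 m f -> measurable_fun [set: borel E] f.
Proof. by move=> /andP[+ _]; rewrite inE. Qed.

Lemma L2T_L2 (f : L2T) : L2 m f.
Proof. exact: LfunP. Qed.

Lemma abse_poweR2 (f : E -> R) x : (`|(f x)%:E| `^ 2 = (f x ^+ 2)%:E)%E.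
Proof. by rewrite /= powR_mulrn// real_normK// num_real. Qed.

Lemma Lnorm2E (f : E -> R) :
  (L2norm m f = (\int[m]_x (f x ^+ 2)%:E) `^ 2^-1)%E.
Proof.
rewrite /L2norm unlock; congr (_ `^ _)%E.
by apply: eq_integral => x _ /=; rewrite -abse_poweR2.
Qed.

Lemma L2P (f : E -> R) : measurable_fun [set: borel E] f ->
  (\int[m]_x (f x ^+ 2)%:E < +oo)%E -> L2 m f.
Proof.
move=> mf fi; apply/andP; split; rewrite inE//=.
rewrite /finite_norm -/(L2norm m f) Lnorm2E; exact: poweR_lty.
Qed.

Lemma L2_le (f g : E -> R) : measurable_fun [set: borel E] f -> L2 m g ->
  (forall x, `|f x| <= `|g x|) -> L2 m f.
Proof.
move=> mf /[dup] /L2_measurable mg Lg fg; apply: L2P => //.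
have /integrableP[_] := Lfun2_integrable_sqr Lg.
apply: le_lt_trans; apply: ge0_le_integral => //=.
- by move=> x _; rewrite lee_fin sqr_ge0.
- by apply/measurable_EFinP; exact: measurable_funX.
- by apply/measurable_EFinP/measurableT_comp => //; exact: measurable_funX.
- by move=> x _; rewrite lee_fin normrX -[leLHS]real_normK ?num_real// lerXn2r ?nnegrE.
Qed.

Lemma L2_integrable_mul f g : L2 m f -> L2 m g ->
  m.-integrable [set: borel E] (EFin \o (fun x => f x * g x)).
Proof. by move=> Lf Lg; apply/Lfun1_integrable; exact: Lfun2_mul_Lfun1. Qed.

Lemma ipL_psd : psd_form setT ipL.
Proof.
split=> // [c u v w _ _ _|u v _ _|u _].
- rewrite /ipL /ip.
  have iuw := L2_integrable_mul _ _ (L2T_L2 u) (L2T_L2 w).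
  have ivw := L2_integrable_mul _ _ (L2T_L2 v) (L2T_L2 w).
  have icuw := L2_integrable_mul _ _ (L2T_L2 (c *: u)) (L2T_L2 w).
  have -> : (\int[m]_x ((c *: u + v) x * w x))%R =
      (\int[m]_x ((c *: u) x * w x + v x * w x))%R.
    by apply: eq_Rintegral => x _; rewrite -mulrDl.
  rewrite RintegralD//; congr (_ + _); rewrite -RintegralZl//.
  by apply: eq_Rintegral => x _; rewrite /= mulrA.
- by apply: eq_Rintegral => x _; rewrite mulrC.
- by apply: Rintegral_ge0 => x _; rewrite -expr2 sqr_ge0.
Qed.

Lemma ipL_EFin (f : L2T) : ((ipL f f)%:E = \int[m]_x (f x ^+ 2)%:E)%E.
Proof.
have /integrable_fin_num := L2_integrable_mul _ _ (L2T_L2 f) (L2T_L2 f).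
by move=> /(_ measurableT)/fineK.
Qed.

Lemma L2norm_seminorm (f : L2T) : L2norm m f = (nm f)%:E.
Proof.
rewrite Lnorm2E -ipL_EFin poweR_EFin /seminorm powR12_sqrt//.
by have := pf_ge0 _ _ ipL_psd f I.
Qed.

Lemma L2_subproof f : L2 m f -> exists g : L2T, g = f :> (E -> R).
Proof. by move=> Lf; exists (Lfun_Sub (lee1n 2) Lf). Qed.

Lemma ipL_ae (f g h : L2T) : {ae m, forall x, f x = g x} -> ipL f h = ipL g h.
Proof.
move=> fg; rewrite /ipL /ip /Rintegral; congr fine; apply: ae_eq_integral => //.
- by have /integrableP[] := L2_integrable_mul _ _ (L2T_L2 f) (L2T_L2 h).
- by have /integrableP[] := L2_integrable_mul _ _ (L2T_L2 g) (L2T_L2 h).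
- by apply: filterS fg => x /= -> _.
Qed.

Lemma nm_ae (f g : L2T) : {ae m, forall x, f x = g x} -> nm f = nm g.
Proof.
move=> fg; apply: (seminorm_ext _ ipL_psd) => h; exact: ipL_ae.
Qed.

(* The series of 4^n r_n^2 is integrable, hence a.e. finite. *)
Lemma fast_ae (r : nat -> L2T) :
  (forall n, 4 ^+ n * ipL (r n) (r n) <= 1 / (2 ^ (n + 1))%:R) ->
  {ae m, forall x, exists C, forall n, `|r n x| <= C * 2 ^- n}.
Proof.
move=> rle.
pose F n x : \bar R := (4 ^+ n * r n x ^+ 2)%:E.
have mr n : measurable_fun [set: borel E] (fun x => r n x ^+ 2).
  by apply: measurable_funX; exact: (L2_measurable _ (L2T_L2 (r n))).
have F0 n x : (0 <= F n x)%E by rewrite lee_fin mulr_ge0 ?sqr_ge0 ?exprn_ge0.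
have mF n : measurable_fun [set: borel E] (F n).
  by apply/measurable_EFinP; exact: measurable_funM.
have intF n : (\int[m]_x F n x <= (1 / (2 ^ (n + 1))%:R)%:E)%E.
  rewrite /F; under eq_integral do rewrite EFinM.
  rewrite ge0_integralZl_EFin ?exprn_ge0//.
  - by rewrite -ipL_EFin -EFinM lee_fin.
  - by move=> x _; rewrite lee_fin sqr_ge0.
  - by apply/measurable_EFinP.
have intS : (\int[m]_x (\sum_(0 <= n <oo) F n x) < +oo)%E.
  rewrite integral_nneseries//.
  apply: (@le_lt_trans _ _ (\sum_(0 <= n <oo) (1 / (2 ^ (n + 1))%:R)%:E)%E).
    by apply: lee_nneseries => // n _ _; exact: integral_ge0.
  by rewrite (cvg_lim _ (@cvg_geometric_eseries_half R 1 0))// expr0 divr1 ltry.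
have iS : m.-integrable [set: borel E] (fun x => \sum_(0 <= n <oo) F n x)%E.
  apply/integrableP; split.
    by apply: ge0_emeasurable_sum => //.
  under eq_integral do rewrite gee0_abs ?nneseries_ge0//.
  exact: intS.
apply: filterS (integrable_ae measurableT iS) => x /= /(_ I) Sfin.
set S := (\sum_(0 <= n <oo) F n x)%E in Sfin.
exists (Num.sqrt (fine S)) => n.
have : (F n x <= S)%E.
  apply: (@le_trans _ _ (\sum_(0 <= i < n.+1) F i x)%E); last exact: nneseries_lim_ge.
  by rewrite big_nat_recr//= leeDr// sume_ge0.
rewrite -(fineK Sfin) lee_fin => le.
rewrite ler_pdivlMr ?exprn_gt0//.
rewrite -sqrtr_sqr -[X in _ * X](ger0_norm (ltW (exprn_gt0 n _)))// -sqrtr_sqr.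
rewrite -sqrtrM ?sqr_ge0// ler_wsqrtr// mulrC (le_trans _ le)//.
by rewrite -exprM mulnC exprM (_ : 2 ^+ 2 = 4 :> R)//; lra.
Qed.

Lemma two_expN_cvg : (2 ^- n : R) @[n --> \oo] --> (0 : R).
Proof.
under eq_fun do rewrite -exprVn.
by apply: cvg_expr; rewrite ger0_norm// invf_lt1// ltr1n.
Qed.

(** Selects indices along which [fast_ae] applies; n <= k n is the form of cofinality that
    [cvg_subindex] asks for. *)
Lemma fast_index (r : nat -> R) :
  r n @[n --> \oo] --> (0 : R) ->
  exists k : nat -> nat, forall n, (n <= k n)%N /\
   4 ^+ n * r (k n) ^+ 2 <= 1 / (2 ^ (n + 1))%:R.
Proof.
move=> r0; suff /choice[k Hk] : forall n : nat, exists i, (n <= i)%N /\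
   4 ^+ n * r i ^+ 2 <= 1 / (2 ^ (n + 1))%:R by exists k.
move=> n; set e : R := 1 / (2 ^ (n + 1))%:R.
have e0 : 0 < e by rewrite divr_gt0// ltr0n expn_gt0.
have : (4 ^+ n * (r i * r i)) @[i --> \oo] --> (0 : R).
  rewrite -[X in _ --> X](mulr0 (4 ^+ n)) -[X in 4 ^+ n * X](mulr0 0).
  by apply: cvgM; [exact: cvg_cst|exact: cvgM].
move/cvgr0Pnorm_lt => /(_ e e0)[N _ HN].
exists (maxn n N); rewrite leq_maxl; split => //.
have /= := HN (maxn n N) (leq_maxr _ _).
by rewrite -expr2 ger0_norm => [/ltW//|]; rewrite mulr_ge0 ?sqr_ge0// exprn_ge0.
Qed.

Lemma cvg_subindex (T : topologicalType) (y : nat -> T) (l : T) (k : nat -> nat) :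
  (forall n, (n <= k n)%N) -> y n @[n --> \oo] --> l -> y (k n) @[n --> \oo] --> l.
Proof.
move=> nk yl; apply: (cvg_comp k y _ yl).
move=> A [N _ HN]; exists N => // n /= Nn; apply: HN => /=.
exact: leq_trans Nn (nk n).
Qed.

(** Along the indices of [fast_index] the error r tends to 0 a.e., and y still tends to z there. *)
Lemma ae_le_lim (r : nat -> L2T) (x : E -> R) (y : nat -> E -> R) (z : E -> R) :
  nm (r n) @[n --> \oo] --> (0 : R) ->
  (forall n, {ae m, forall w, x w <= y n w + r n w}) ->
  {ae m, forall w, y n w @[n --> \oo] --> z w} ->
  {ae m, forall w, x w <= z w}.
Proof.
move=> r0 /ae_foralln xyr yz.
have [k Hk] := fast_index _ r0.
have : {ae m, forall w, exists C, forall n, `|r (k n) w| <= C * 2 ^- n}.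
  by apply: fast_ae => n; have [_] := Hk n; rewrite (sqr_seminorm _ _ ipL_psd).
move=> fast; apply: filterS3 fast xyr yz => w [C HC] {}xyr {}yz.
have yk : y (k n) w @[n --> \oo] --> z w.
  by apply: (cvg_subindex _ (fun n => y n w)) => // n; have [] := Hk n.
have rk : r (k n) w @[n --> \oo] --> (0 : R).
  apply/norm_cvg0P; apply: (@cvgr0_le _ _ _ _ _ (fun n => C * 2 ^- n)).
    by apply: nearW => n; rewrite normr_ge0/=.
  rewrite -[X in _ --> X](mulr0 C); apply: cvgM; first exact: cvg_cst.
  exact: two_expN_cvg.
have yr : (y (k n) w + r (k n) w) @[n --> \oo] --> z w.
  by rewrite -[z w]addr0; exact: cvgD.
rewrite -(cvg_lim _ yr)//; apply: limr_ge; first by apply/cvg_ex; eexists; exact: yr.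
exact: nearW.
Qed.

(** Riesz-Fischer: increments along a fast subsequence are geometrically small a.e., which gives a
    pointwise limit; Fatou returns the L^2 estimate. *)
Lemma ipL_complete (s : nat -> L2T) : form_cauchy ipL s ->
  exists u : L2T, nm (s n - u) @[n --> \oo] --> (0 : R).
Proof.
move=> sC.
have /choice[N HN] : forall k : nat, exists n, forall i j, (n <= i)%N -> (n <= j)%N ->
    4 ^+ k * ipL (s i - s j) (s i - s j) <= 1 / (2 ^ (k + 1))%:R.
  move=> k; have e0 : 0 < (4 ^+ k)^-1 * (1 / (2 ^ (k + 1))%:R) :> R.
    by rewrite mulr_gt0 ?invr_gt0 ?exprn_gt0// divr_gt0// ltr0n expn_gt0.
  have [n Hn] := sC _ e0; exists n => i j ni nj.
  by rewrite -ler_pdivlMl ?exprn_gt0//; exact/ltW/Hn.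
(* Partial sums are monotone in k and stay above N k. *)
pose M k := (\sum_(i < k.+1) N i)%N.
have NM k : (N k <= M k)%N by rewrite /M big_ord_recr/= leq_addl.
have MS k : (M k <= M k.+1)%N by rewrite /M [leqRHS]big_ord_recr/= leq_addr.
have fast : {ae m, forall x, exists C, forall n,
    `|(s (M n.+1) - s (M n)) x| <= C * 2 ^- n}.
  by apply: fast_ae => k; apply: HN => //; exact: leq_trans (NM k) (MS k).
(* The upper limit is measurable and defined everywhere; a.e. it is the limit. *)
pose u0 x := limn_esup (fun k => (s (M k) x)%:E).
have ms n : measurable_fun [set: borel E] (s n) := L2_measurable _ (L2T_L2 (s n)).
have mu0 : measurable_fun [set: borel E] u0.
  by apply: measurable_fun_limn_esup => k; apply/measurable_EFinP.
have mfu : measurable_fun [set: borel E] (fine \o u0).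
  exact: measurableT_comp.
have su : {ae m, forall x, s (M k) x @[k --> \oo] --> fine (u0 x)}.
  apply: filterS fast => x [C HC].
  have : cvgn (fun k => s (M k) x).
    have -> : (fun k => s (M k) x) =
        (fun k => s (M 0%N) x + series (fun i => (s (M i.+1) - s (M i)) x) k).
      by apply/funext => k; exact: (eq_sum_telescope (fun k => s (M k) x)).
    apply: is_cvgD; first exact: is_cvg_cst.
    apply: normed_cvg; apply: (series_le_cvg _ _ HC) => //.
      by move=> n; apply: le_trans (HC n).
    rewrite (_ : (fun n => C * 2 ^- n) = geometric C 2^-1).
      by apply: is_cvg_geometric_series; rewrite ger0_norm// invf_lt1// ltr1n.
    by apply/funext => n; rewrite /geometric/= exprVn.
  move=> /cvg_ex[l sl].
  have sE : (s (M k) x)%:E @[k --> \oo] --> l%:E.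
    by apply: cvg_EFin; [exact: nearW|exact: sl].
  by rewrite /u0 (cvg_limn_einf_sup sE).2.
(* Fatou in i along s (M (k + i)), whose indices are all at least N k. *)
have bound k n : (N k <= n)%N ->
    (\int[m]_x ((s n x - fine (u0 x)) ^+ 2)%:E <= (1 / (2 ^ (k + 1))%:R)%:E)%E.
  move=> kn.
  pose g i x := ((s n x - s (M (k + i)%N) x) ^+ 2)%:E.
  have mg i : measurable_fun [set: borel E] (g i).
    by apply/measurable_EFinP; apply: measurable_funX; exact: measurable_funB.
  have mlim : measurable_fun [set: borel E] (fun x => limn_einf (g ^~ x)).
    have -> : (fun x => limn_einf (g ^~ x)) =
              (fun x => - limn_esup ((fun i => \- g i)%E ^~ x))%E.
      apply/funext => x; rewrite -limn_einfN; congr limn_einf.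
      by apply/funext => i; exact/esym/oppeK.
    apply: measurableT_comp => //.
    by apply: measurable_fun_limn_esup => i; exact: measurableT_comp.
  apply: (@le_trans _ _ (\int[m]_x limn_einf (g ^~ x))%E).
    have glim : {ae m, forall x, limn_einf (g ^~ x) = ((s n x - fine (u0 x)) ^+ 2)%:E}.
      apply: filterS su => x sx.
      have : g i x @[i --> \oo] --> ((s n x - fine (u0 x)) ^+ 2)%:E.
        apply: cvg_EFin; first exact: nearW.
        have d : (s n x - s (M (k + i)%N) x) @[i --> \oo] --> s n x - fine (u0 x).
          apply: cvgB; first exact: cvg_cst.
          apply: (cvg_subindex _ (fun i => s (M i) x)) => // i; exact: leq_addl.
        rewrite (_ : fine \o _ = (fun i => (s n x - s (M (k + i)%N) x) *
            (s n x - s (M (k + i)%N) x))).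
          by rewrite expr2; exact: cvgM.
        by apply/funext => i /=; rewrite expr2.
      by move=> gE; rewrite (cvg_limn_einf_sup gE).1.
    rewrite le_eqVlt; apply/orP; left; apply/eqP; apply: ae_eq_integral => //.
    - by apply/measurable_EFinP; apply: measurable_funX; exact: measurable_funB.
    - by apply: filterS glim => x -> _.
  apply: le_trans (fatou m measurableT mg _) _.
    by move=> i x _; rewrite lee_fin sqr_ge0.
  rewrite limn_einf_lim; apply: lime_le; first exact: is_cvg_einfs.
  apply: nearW => j; apply: (@le_trans _ _ (\int[m]_x g j x)%E).
    by apply: ereal_inf_lbound; exists j => /=.
  rewrite (_ : (\int[m]_x g j x)%E =
      (ipL (s n - s (M (k + j)%N)) (s n - s (M (k + j)%N)))%:E).
    rewrite lee_fin (le_trans _ (HN k n (M (k + j)%N) kn _))//.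
      rewrite ler_peMl ?(pf_ge0 _ _ ipL_psd)//.
      by rewrite exprn_ege1// ler1n.
    rewrite (leq_trans (NM k))//; elim: j => [|j IH]; first by rewrite addn0.
    by rewrite addnS (leq_trans IH).
  by rewrite ipL_EFin.
have Lu : L2 m (fine \o u0).
  have mw : measurable_fun [set: borel E] (fun x => s (N 0%N) x - fine (u0 x)).
    exact: measurable_funB.
  have Lw : L2 m (fun x => s (N 0%N) x - fine (u0 x)).
    by apply: L2P => //; apply: le_lt_trans (bound 0%N _ (leqnn _)) _; rewrite ltry.
  have [w ww] := L2_subproof _ Lw.
  have -> : fine \o u0 = (s (N 0%N) - w : L2T) :> (E -> R).
    apply/funext => x; rewrite -[RHS]/(s (N 0%N) x - w x) ww /=.
    by rewrite opprB addrC subrK.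
  exact: L2T_L2.
have [u uE] := L2_subproof _ Lu; exists u.
have nmE n : nm (s n - u) ^+ 2 = ipL (s n - u) (s n - u).
  by rewrite (sqr_seminorm _ _ ipL_psd).
apply: (@cvgr0_le _ _ _ _ _ (fun n => Num.sqrt (ipL (s n - u) (s n - u)))).
  by apply: nearW => n; rewrite seminorm_ge0 lexx.
apply: cvgr0_sqrt; apply/cvgr0Pnorm_le => e e0.
have [k ke] : exists k : nat, 1 / (2 ^ (k + 1))%:R <= e.
  have /cvgr0Pnorm_lt/(_ e e0)[k _ Hk] := two_expN_cvg.
  exists k; rewrite ltW// (le_lt_trans _ (Hk k (leqnn k)))//.
  rewrite ger0_norm ?invr_ge0 ?exprn_ge0// mul1r natrX lef_pV2 ?posrE ?exprn_gt0//.
  by rewrite ler_weXn2l ?leq_addr// ler1n.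
exists (N k) => // n /= kn; rewrite ger0_norm ?(pf_ge0 _ _ ipL_psd)//.
apply: le_trans ke; rewrite -lee_fin ipL_EFin.
apply: le_trans (bound k n kn); rewrite le_eqVlt; apply/orP; left; apply/eqP.
by apply: eq_integral => x _ /=; rewrite uE.
Qed.

End SquareIntegrable.

(** * Invariance of the limit *)

Section Invariance.
Context {R : realType} {E : pmetricType R}.
Variable m : {measure set (borel E) -> \bar R}.
Local Notation L2T := (LfunType m (lee1n 2)).
Local Notation ipL := (ipL m).
Local Notation nm := (seminorm ipL).
Local Notation ipP := (ipL_psd m).

Lemma L2T_measurable (f : L2T) : measurable_fun [set: borel E] f.
Proof. exact: (L2_measurable _ _ (L2T_L2 _ f)). Qed.

Lemma L2TB (f g : L2T) x : (f - g) x = f x - g x.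
Proof. by []. Qed.

Lemma ipL_le (f g h k : L2T) : {ae m, forall x, f x * g x <= h x * k x} ->
  ipL f g <= ipL h k.
Proof.
move=> le; rewrite -subr_ge0 /ipL /ip.
have i1 := L2_integrable_mul _ _ _ (L2T_L2 _ f) (L2T_L2 _ g).
have i2 := L2_integrable_mul _ _ _ (L2T_L2 _ h) (L2T_L2 _ k).
rewrite -RintegralB//.
(* The integrand is non-negative only a.e.; the modulus makes it so everywhere. *)
have -> : \int[m]_x (h x * k x - f x * g x) = \int[m]_x `|h x * k x - f x * g x|.
  rewrite /Rintegral; congr fine; apply: ae_eq_integral => //.
  - by apply/measurable_EFinP; apply: measurable_funB; apply: measurable_funM; exact: L2T_measurable.
  - apply/measurable_EFinP; apply: measurableT_comp => //.
    by apply: measurable_funB; apply: measurable_funM; exact: L2T_measurable.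
  - by apply: filterS le => x le _; rewrite ger0_norm// subr_ge0.
by apply: Rintegral_ge0.
Qed.

Lemma L2_dominated (g : nat -> L2T) (f h : L2T) :
  {ae m, forall x, g n x @[n --> \oo] --> f x} ->
  (forall n, {ae m, forall x, `|g n x - f x| <= `|h x|}) ->
  nm (g n - f) @[n --> \oo] --> (0 : R).
Proof.
move=> gf /ae_foralln gh.
have mL (u : L2T) : measurable_fun [set: borel E] u := L2_measurable _ _ (L2T_L2 _ u).
pose F n x := ((g n x - f x) ^+ 2)%:E.
have mF n : measurable_fun [set: borel E] (F n).
  by apply/measurable_EFinP; apply: measurable_funX; exact: measurable_funB.
have [|||_ _] := @dominated_convergence _ _ _ m setT measurableT F (cst 0%E)
    (fun x => (h x ^+ 2)%:E) mF (measurable_cst _).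
- apply: filterS gf => x gx _; apply: cvg_EFin; first exact: nearW.
  have d : (g n x - f x) @[n --> \oo] --> (0 : R).
    by rewrite -(subrr (f x)); apply: cvgB => //; exact: cvg_cst.
  rewrite (_ : fine \o _ = (fun n => (g n x - f x) * (g n x - f x))).
    by rewrite -[X in _ --> X](mulr0 0); exact: cvgM.
  by apply/funext => n /=; rewrite expr2.
- exact: (Lfun2_integrable_sqr (L2T_L2 _ h)).
- apply: filterS gh => x gx n _.
  rewrite /F lee_fin ger0_norm ?sqr_ge0// -[leLHS]real_normK ?num_real//.
  by rewrite -[leRHS]real_normK ?num_real// lerXn2r ?nnegrE.
rewrite integral0 => I0; apply: cvgr0_sqrt.
have /fine_cvgP[_] := I0; apply: cvg_trans; apply: near_eq_cvg; apply: nearW => n /=.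
by rewrite -[ipL _ _]/(fine _%:E) ipL_EFin.
Qed.

Lemma L2T_exists (f : E -> R) (g : L2T) : measurable_fun [set: borel E] f ->
  (forall x, `|f x| <= `|g x|) -> exists h : L2T, h = f :> (E -> R).
Proof. by move=> mf fg; apply: L2_subproof; exact: L2_le (L2T_L2 _ g) fg. Qed.

Lemma nm_cvgD (s t : nat -> L2T) : nm (s n) @[n --> \oo] --> (0 : R) ->
  nm (t n) @[n --> \oo] --> (0 : R) -> nm (s n + t n) @[n --> \oo] --> (0 : R).
Proof.
move=> s0 t0; apply: (@cvgr0_le _ _ _ _ _ (fun n => nm (s n) + nm (t n))).
  by apply: nearW => n; rewrite seminorm_ge0 (seminormD _ _ ipP).
by rewrite -[X in _ --> X](addr0 0); exact: cvgD.
Qed.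

(** * Invariance under a symmetric positivity preserving contraction *)

Context (P : L2T -> L2T).
Hypothesis P_linear : forall c f g,
  {ae m, forall x, P (c *: f + g) x = c * P f x + P g x}.
Hypothesis P_ge0 : forall f : L2T, {ae m, forall x, 0 <= f x} ->
  {ae m, forall x, 0 <= P f x}.
Hypothesis P_contraction : forall f, nm (P f) <= nm f.
Hypothesis P_sym : forall f g, ipL (P f) g = ipL f (P g).
Hypothesis P_decrement : forall f, nm (f - P f) ^+ 2 <= ipL (f - P f) f.

Lemma PB f g : {ae m, forall x, P (f - g) x = P f x - P g x}.
Proof.
apply: filterS (P_linear (-1) g f) => x.
by rewrite scaleN1r addrC => ->; rewrite mulN1r addrC.
Qed.

Lemma P_le (f g : L2T) : {ae m, forall x, f x <= g x} ->
  {ae m, forall x, P f x <= P g x}.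
Proof.
move=> fg; have : {ae m, forall x, 0 <= P (g - f) x}.
  by apply: P_ge0; apply: filterS fg => x; rewrite -subr_ge0.
by apply: filterS2 (PB g f) => x ->; rewrite subr_ge0.
Qed.

Lemma P_lipschitz f g : nm (P f - P g) <= nm (f - g).
Proof.
rewrite -(nm_ae _ (P (f - g)) (P f - P g)) ?P_contraction//.
by apply: filterS (PB f g) => x ->.
Qed.

Lemma P_cvg (s : nat -> L2T) f : nm (s n - f) @[n --> \oo] --> (0 : R) ->
  nm (P f - P (s n)) @[n --> \oo] --> (0 : R).
Proof.
apply: cvgr0_le; apply: nearW => n; rewrite seminorm_ge0/=.
by rewrite (seminorm_distC _ _ ipP)// P_lipschitz.
Qed.

(** |P u| <= P |u| gives u P u <= |u| P |u| a.e. The comparison is made for P because the modulus is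
    controlled in the form only on the core. *)
Lemma decrement_abs (u v : L2T) : (forall x, v x = `|u x|) ->
  ipL (v - P v) v <= ipL (u - P u) u.
Proof.
move=> vE; apply: ipL_le.
have h1 : {ae m, forall x, P u x <= P v x}.
  by apply: P_le; apply: nearW => x; rewrite vE ler_norm.
have h2 : {ae m, forall x, 0 <= P (1 *: u + v) x}.
  apply: P_ge0; apply: nearW => x.
  rewrite -[X in 0 <= X]/(1 * u x + v x) vE mul1r -lerBlDl sub0r -normrN.
  exact: ler_norm.
apply: filterS3 h1 h2 (P_linear 1 u v) => x p1 + p2; rewrite p2 mul1r => {p2} p2.
rewrite !L2TB !vE.
have [u0|u0] := lerP 0 (u x).
  have : 0 <= u x * (P v x - P u x) by rewrite mulr_ge0// subr_ge0.
  by rewrite ger0_norm//; lra.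
have : 0 <= - u x * (P u x + P v x) by rewrite mulr_ge0// oppr_ge0 ltW.
by rewrite ltr0_norm//; lra.
Qed.

Context (Phi : E -> R).
Hypothesis Phi_measurable : measurable_fun [set: borel E] Phi.
Hypothesis Phi_ge0 : forall x, 0 <= Phi x.
Context (u : nat -> L2T).
Hypothesis u_cvg : {ae m, forall x, u n x @[n --> \oo] --> Phi x}.
Hypothesis u_decrement : ipL (u n - P (u n)) (u n) @[n --> \oo] --> (0 : R).

Lemma decrement_cvg (v : nat -> L2T) :
  ipL (v n - P (v n)) (v n) @[n --> \oo] --> (0 : R) ->
  nm (v n - P (v n)) @[n --> \oo] --> (0 : R).
Proof.
move=> /cvgr0_sqrt; apply: cvgr0_le; apply: nearW => n; rewrite seminorm_ge0/=.
by rewrite -(ger0_norm (seminorm_ge0 _ _)) -sqrtr_sqr ler_wsqrtr.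
Qed.

Lemma abs_sequence : exists v : nat -> L2T, [/\
  forall n x, 0 <= v n x,
  {ae m, forall x, v n x @[n --> \oo] --> Phi x} &
  ipL (v n - P (v n)) (v n) @[n --> \oo] --> (0 : R)].
Proof.
have /choice[v vE] : forall n, exists h : L2T, h = (fun x => `|u n x|) :> (E -> R).
  move=> n; apply: (L2T_exists _ (u n)) => [|x]; last by rewrite normr_id.
  by apply: measurableT_comp => //; exact: L2T_measurable.
exists v; split => [n x||]; first by rewrite vE.
- apply: filterS u_cvg => x ux.
  rewrite -[Phi x]ger0_norm// (_ : (fun n => v n x) = (fun n => `|u n x|)).
    exact: cvg_norm.
  by apply/funext => n; rewrite vE.
- apply: cvgr0_le u_decrement; apply: nearW => n.
  rewrite (le_trans (sqr_ge0 _) (P_decrement _))/=.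
  by apply: decrement_abs => x; rewrite vE.
Qed.

Lemma min_cvg (y : nat -> R) (a b : R) : y n @[n --> \oo] --> b ->
  Num.min a (y n) @[n --> \oo] --> Num.min a b.
Proof.
move=> yb; under eq_fun do rewrite minr_absE.
rewrite minr_absE; apply: cvgM; last exact: cvg_cst.
by apply: cvgB; [apply: cvgD => //; exact: cvg_cst|
  apply: cvg_norm; apply: cvgB => //; exact: cvg_cst].
Qed.

(* P f <= lim P v_n = Phi, because f is the L^2-limit of min(f, v_n) <= v_n *)
Lemma P_below (f : L2T) : {ae m, forall x, 0 <= f x <= Phi x} ->
  {ae m, forall x, P f x <= Phi x}.
Proof.
move=> f0P; have [v [v0 vP vd]] := abs_sequence.
(* The modulus of f is taken because f >= 0 holds only a.e., while [L2T_exists] asks for a bound at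
   every point. *)
have /choice[g gE] : forall n, exists h : L2T,
    h = (fun x => Num.min `|f x| (v n x)) :> (E -> R).
  move=> n; apply: (L2T_exists _ f) => [|x].
    by apply: measurable_minr; [apply: measurableT_comp => //|]; exact: L2T_measurable.
  by rewrite ger0_norm ?ge_min ?lexx// le_min normr_ge0 v0.
have gf : nm (g n - f) @[n --> \oo] --> (0 : R).
  apply: (L2_dominated _ _ f).
    apply: filterS2 f0P vP => x /andP[f0 fP] vx.
    rewrite (_ : (fun n => g n x) = (fun n => Num.min (f x) (v n x))).
      by have := min_cvg _ (f x) _ vx; rewrite min_l.
    by apply/funext => n; rewrite gE ger0_norm.
  move=> n; apply: filterS f0P => x /andP[f0 fP]; rewrite gE (ger0_norm f0).
  have := v0 n x; rewrite ler0_norm; last by rewrite subr_le0 ge_min lexx.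
  by rewrite minEle; case: ifP => _; lra.
(* P f = P (g n) + (P f - P (g n)) and P (g n) <= P (v n) = v n + (P (v n) - v n). *)
apply: (ae_le_lim _ (fun n => (P f - P (g n)) + (P (v n) - v n)) _ v) => //.
- apply: nm_cvgD; first exact: P_cvg.
  apply: cvg_trans (decrement_cvg _ vd); apply: near_eq_cvg; apply: nearW => n.
  exact: (seminorm_distC _ _ ipP).
- move=> n; have : {ae m, forall x, P (g n) x <= P (v n) x}.
    by apply: P_le; apply: nearW => x; rewrite gE ge_min lexx orbT.
  apply: filterS => x.
  rewrite -[(_ + _ : L2T) x]/((P f x - P (g n) x) + (P (v n) x - v n x)).
  lra.
Qed.

(** The increasing sequence f is arbitrary, so that the one selected by [get] in [monotone_ext] is
    covered. *)
Theorem invariant_limit (f : nat -> L2T) :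
  (forall n, {ae m, forall x, 0 <= f n x <= f n.+1 x}) ->
  {ae m, forall x, f n x @[n --> \oo] --> Phi x} ->
  {ae m, forall x, P (f n) x @[n --> \oo] --> Phi x}.
Proof.
move=> /[dup] f_mono /ae_foralln f_mon f_cvg.
have f_le : {ae m, forall x n, f n x <= Phi x}.
  apply: filterS2 f_mon f_cvg => x fx fP n.
  rewrite -(cvg_lim _ fP)//; apply: nondecreasing_cvgn_le.
    by apply/nondecreasing_seqP => k; have /andP[] := fx k.
  by apply/cvg_ex; exists (Phi x).
have Pf_le : {ae m, forall x n, P (f n) x <= Phi x}.
  apply: ae_foralln => n; apply: P_below.
  by apply: filterS2 f_mon f_le => x /(_ n)/andP[-> _] /(_ n) ->.
have Pf_mono : {ae m, forall x n, P (f n) x <= P (f n.+1) x}.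
  by apply: ae_foralln => n; apply: P_le; apply: filterS (f_mono n) => x /andP[].
pose Psi x := limn (fun n => P (f n) x).
have Psi_cvg : {ae m, forall x, P (f n) x @[n --> \oo] --> Psi x}.
  apply: filterS2 Pf_le Pf_mono => x le mono.
  apply: nondecreasing_is_cvgn; first exact/nondecreasing_seqP.
  by exists (Phi x) => _ [n _ <-].
have Psi_le : {ae m, forall x, Psi x <= Phi x}.
  apply: filterS2 Pf_le Psi_cvg => x le cv.
  apply: limr_le; first by apply/cvg_ex; exists (Psi x).
  exact: nearW.
(* Signs are reversed to fit [ae_le_lim]: - Psi <= - w n + (w n - P (w n)). *)
suff : {ae m, forall x, - Psi x <= - Phi x}.
  apply: filterS3 Psi_cvg Psi_le => x cv le; rewrite lerN2 => ge.
  by rewrite (@le_anti _ _ (Phi x) (Psi x)) ?le ?ge.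
have [v [v0 vP vd]] := abs_sequence.
have /choice[w wE] : forall n, exists h : L2T,
    h = (fun x => Num.min (Phi x) (v n x)) :> (E -> R).
  move=> n; apply: (L2T_exists _ (v n)) => [|x].
    by apply: measurable_minr => //; exact: L2T_measurable.
  by rewrite !ger0_norm ?ge_min ?lexx ?orbT// le_min Phi_ge0 v0.
have w0 n x : 0 <= w n x by rewrite wE le_min Phi_ge0 v0.
(* Since f k increases to Phi >= w n, the minimum h k of w n and f k tends to w n in L^2, and P (h
   k) <= P (f k) passes to the limit. *)
have Pw n : {ae m, forall x, P (w n) x <= Psi x}.
  have /choice[h hE] : forall k, exists h : L2T,
      h = (fun x => Num.min (w n x) `|f k x|) :> (E -> R).
    move=> k; apply: (L2T_exists _ (w n)) => [|x].
      by apply: measurable_minr; [|apply: measurableT_comp => //]; exact: L2T_measurable.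
    by rewrite (ger0_norm (w0 n x)) ger0_norm ?ge_min ?lexx// le_min w0 normr_ge0.
  apply: (ae_le_lim _ (fun k => P (w n) - P (h k)) _ (fun k => P (f k))) => //.
    apply: P_cvg; apply: (L2_dominated _ _ (w n)).
      apply: filterS f_cvg => x fx.
      rewrite (_ : (fun k => h k x) = (fun k => Num.min (w n x) `|f k x|)).
        have wx : Num.min (w n x) (Phi x) = w n x by rewrite min_l// wE ge_min lexx.
        rewrite -[X in _ --> X]wx -(ger0_norm (Phi_ge0 x)).
        by apply: min_cvg; exact: cvg_norm.
      by apply/funext => k; rewrite hE.
    move=> k; apply: nearW => x; rewrite hE !(ger0_norm (w0 n x)).
    rewrite ler0_norm; last by rewrite subr_le0 ge_min lexx.
    have := w0 n x; have := normr_ge0 (f k x).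
    by rewrite minEle; case: ifP => _; lra.
  move=> k; have : {ae m, forall x, P (h k) x <= P (f k) x}.
    apply: P_le; apply: filterS (f_mono k) => x /andP[f0 _].
    by rewrite hE ger0_norm// ge_min lexx orbT.
  apply: filterS => x; rewrite -[(_ - _ : L2T) x]/(P (w n) x - P (h k) x); lra.
have wd : ipL (w n - P (w n)) (w n) @[n --> \oo] --> (0 : R).
  apply: cvgr0_le vd; apply: nearW => n.
  rewrite (le_trans (sqr_ge0 _) (P_decrement _))/=.
  have [r rE] : exists r : L2T, r = v n - w n by eexists.
  have r0 x : 0 <= r x by rewrite rE L2TB subr_ge0 wE ge_min lexx orbT.
  have rr := le_trans (sqr_ge0 _) (P_decrement r).
  (* Where r > 0 one has w n = Phi, and P (w n) <= Psi <= Phi there. *)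
  have wr : 0 <= ipL (w n - P (w n)) r.
    rewrite -[leLHS](pf0l _ _ ipP r)//; apply: ipL_le.
    apply: filterS2 (Pw n) Psi_le => x pw psi; rewrite -[(0 : L2T) x]/(0 : R) mul0r.
    rewrite -[(_ - _ : L2T) x]/(w n x - P (w n) x) rE L2TB wE.
    rewrite minEle; case: ifP => [le|_]; last by rewrite subrr mulr0.
    by apply: mulr_ge0; rewrite subr_ge0// (le_trans pw).
  (* By symmetry (v - P v, v) = (w - P w, w) + 2 (w - P w, r) + (r - P r, r), with the last two
     terms non-negative. *)
  have -> : v n = w n + r by rewrite rE addrC subrK.
  have Pwr z : ipL (P (w n + r)) z = ipL (P (w n)) z + ipL (P r) z.
    rewrite -(pfDl _ _ ipP)//; apply: ipL_ae.
    by apply: filterS (P_linear 1 (w n) r) => x; rewrite scale1r mul1r.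
  move: rr wr; rewrite !(pfBl _ _ ipP)// Pwr !(pfDl _ _ ipP)// !(pfDr _ _ ipP)//.
  rewrite (P_sym r (w n)) (pf_sym _ _ ipP r (P (w n)))// (pf_sym _ _ ipP r (w n))//.
  lra.
apply: (ae_le_lim _ (fun n => w n - P (w n)) _ (fun n => - w n)).
- exact: decrement_cvg.
- move=> n; apply: filterS (Pw n) => x.
  rewrite -[(_ - _ : L2T) x]/(w n x - P (w n) x) -[(- w n : L2T) x]/(- w n x).
  by rewrite /=; lra.
- apply: filterS vP => x vx.
  rewrite (_ : (fun n => (- w n : L2T) x) = (fun n => - Num.min (Phi x) (v n x))).
    by apply: cvgN; have := min_cvg _ (Phi x) _ vx; rewrite minxx.
  by apply/funext => n; rewrite -[LHS]/(- w n x) wE.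
Qed.

End Invariance.

(** * The Schrodinger form *)

Section CompactSupport.
Context {R : realType} {E : pmetricType R}.
Local Notation C0 := (@C0 R E).

Lemma continuous_borel_measurable (u : E -> R) : continuous u ->
  measurable_fun [set: borel E] u.
Proof.
move=> /continuousP cu; apply: (measurability _ (RGenOpens.measurableE R)).
move=> _ [_ [a [b ->] <-]]; rewrite setTI; apply: sub_sigma_algebra.
by apply: cu; exact: interval_open.
Qed.

Lemma C0_bounded (u : E -> R) : C0 u -> exists M, forall x, `|u x| <= M.
Proof.
move=> [cu cK]; set K := closure _ in cK.
have /compact_bounded[M [_ HM]] : compact (u @` K).
  by apply: continuous_compact => //; exact: continuous_subspaceT.
exists (`|M| + 1) => x; have [->|u0] := eqVneq (u x) 0.
  by rewrite normr0 addr_ge0.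
apply: (HM (`|M| + 1)); first by rewrite ltr_pwDr// ler_norm.
by exists x => //; exact: subset_closure.
Qed.

Lemma C0_linear c u v : C0 u -> C0 v -> C0 (c *: u + v).
Proof.
move=> [cu Ku] [cv Kv]; split.
  move=> x; apply: (@continuousD _ _ _ (c *: u) v); last exact: cv.
  by apply: continuousZl_tmp; exact: cu.
have KU : compact (closure [set x | u x != 0] `|` closure [set x | v x != 0]).
  exact: compactU.
apply: (subclosed_compact _ KU); first exact: closed_closure.
rewrite -closureU; apply: closureS => x /= uv0.
have [u0|] := eqVneq (u x) 0; last by left.
right; move: uv0; rewrite -[(c *: u + v) x]/(c * u x + v x) u0 mulr0 add0r //.
Qed.

Lemma C0_norm u : C0 u -> C0 (fun x => `|u x|).
Proof.
move=> [cu Ku]; split.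
  by move=> x; apply: cvg_norm; exact: cu.
rewrite (_ : [set x | `|u x| != 0] = [set x | u x != 0])//.
by apply/seteqP; split => x /=; rewrite normr_eq0.
Qed.

Lemma C0_cst0 : C0 (cst 0).
Proof.
split; first by move=> x; exact: cvg_cst.
rewrite (_ : [set x | _] = set0) ?closure0; first exact: compact0.
by apply/seteqP; split => x //=; rewrite eqxx.
Qed.

Lemma C0_integrable_mul (nu : {measure set (borel E) -> \bar R}) u v :
  radon nu -> C0 u -> C0 v ->
  nu.-integrable [set: borel E] (EFin \o (fun x => u x * v x)).
Proof.
move=> nuR Cu Cv.
have mu' := continuous_borel_measurable _ Cu.1.
have mv := continuous_borel_measurable _ Cv.1.
have [M uM] := C0_bounded _ Cu; have [N vN] := C0_bounded _ Cv.
pose K : set (borel E) := closure [set x | u x != 0].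
have mK : measurable K.
  rewrite -[K]setCK; apply: measurableC; apply: sub_sigma_algebra.
  by rewrite /= openC; exact: closed_closure.
have M0 : 0 <= M by exact: le_trans (uM point).
have N0 : 0 <= N by exact: le_trans (vN point).
apply/integrableP; split.
  by apply/measurable_EFinP; exact: measurable_funM.
(* The product is bounded by M N and vanishes off the compact support K of u, which has finite
   measure. *)
apply: (@le_lt_trans _ _ (\int[nu]_x ((M * N)%:E * (\1_K x)%:E))%E).
  apply: ge0_le_integral => //.
  - by apply/measurable_EFinP; apply: measurableT_comp => //; exact: measurable_funM.
  - by apply/measurable_EFinP; apply: measurable_funM => //; exact: measurable_indic.
  - move=> x _ /=; rewrite -EFinM lee_fin normrM indicE.
    have [xK|xK] := boolP (x \in K); first by rewrite mulr1 ler_pM.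
    have -> : u x = 0.
      apply/eqP; apply: contraNT xK => ux; rewrite inE; exact: subset_closure.
    by rewrite normr0 mul0r mulr0.
have mI : measurable_fun [set: borel E] (fun x => (\1_K x)%:E : \bar R).
  by apply/measurable_EFinP; exact: measurable_indic.
have I0 x : [set: borel E] x -> (0 <= (\1_K x)%:E :> \bar R)%E.
  by move=> _; rewrite lee_fin indicE.
rewrite (ge0_integralZl_EFin _ measurableT I0 mI (mulr_ge0 M0 N0)).
rewrite integral_indic// setIT lte_mul_pinfty// ?lee_fin ?mulr_ge0//.
by apply: nuR; exact: Cu.2.
Qed.

End CompactSupport.

(** * The modulus on the Dirichlet form and on the core of the Schrodinger form *)

Section Core.
Context {R : realType} {E : pmetricType R}.
Variable m : {measure set (borel E) -> \bar R}.
Context (a : l2form E).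
Hypothesis a_symm : symm_form m a.
Hypothesis a_markov : markovian a.

Lemma symm_psd_form : psd_form (dom a) a.
Proof.
case: a_symm => _ d0 dP _ _ lin sym ge0 _; by split => // c u v Du Dv; exact: dP.
Qed.
Local Notation aP := symm_psd_form.

(** The Markov property is applied to u / n with n above sup |u|: the cut at 1 then has no effect,
    and rescaling leaves the positive part. *)
Lemma form_pos_part u M : dom a u -> (forall x, `|u x| <= M) ->
  let v := fun x => Num.max (u x) 0 in dom a v /\ a v v <= a u u.
Proof.
move=> Du uM /=; pose n := `|M| + 1.
have n0 : 0 < n by rewrite ltr_wpDl.
have Dn := pf_domZ _ _ aP n^-1 _ Du.
have [] := a_markov _ Dn; set w := fun x => Num.min _ _ => Dw aw.
have -> : (fun x => Num.max (u x) 0) = n *: w.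
  apply/funext => x; rewrite -[RHS]/(n * Num.min (Num.max (n^-1 * u x) 0) 1).
  have un : u x <= n.
    have := uM x; have := ler_norm (u x); have := ler_norm M; rewrite /n; lra.
  have [u0|u0] := lerP 0 (u x).
    have h : 0 <= n^-1 * u x by rewrite mulr_ge0// invr_ge0 ltW.
    have h1 : n^-1 * u x <= 1 by rewrite mulrC ler_pdivrMr// mul1r.
    by rewrite (max_l h) (min_l h1) mulrA divff ?mul1r ?gt_eqF.
  have h : n^-1 * u x <= 0 by rewrite mulr_ge0_le0 ?invr_ge0// ltW.
  by rewrite (max_r h) min_l ?mulr0.
split; first exact: (pf_domZ _ _ aP).
rewrite (pfZl _ _ aP) ?(pfZr _ _ aP)//; last exact: (pf_domZ _ _ aP).
move: aw; rewrite (pfZl _ _ aP) ?(pfZr _ _ aP)// => aw.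
rewrite mulrA -expr2 -ler_pdivlMl ?exprn_gt0//.
by rewrite -exprVn expr2 -mulrA.
Qed.

(* Truncating u^+ - l u^- gives a(u^+, u^-) <= 0 as l tends to 0. *)
Lemma form_abs u M : dom a u -> (forall x, `|u x| <= M) ->
  let v := fun x => `|u x| in dom a v /\ a v v <= a u u.
Proof.
move=> Du uM /=.
have [] := form_pos_part _ _ Du uM; set p := fun x => _ => Dp ap.
have DNu := pf_domZ _ _ aP (-1) _ Du.
have [|] := form_pos_part _ M DNu.
  by move=> x; rewrite -[(_ *: _) x]/(-1 * u x) mulN1r normrN.
set n := fun x => _ => Dn an.
have nE x : n x = Num.max (- u x) 0.
  by rewrite /n -[(_ *: _) x]/(-1 * u x) mulN1r.
have p0 x : 0 <= p x by rewrite /p le_max lexx orbT.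
have n0 x : 0 <= n x by rewrite nE le_max lexx orbT.
have uE : u = p - n.
  apply/funext => x; rewrite -[RHS]/(p x - n x) nE /p.
  by have [u0|u0] := lerP 0 (u x); [rewrite max_r ?subr0// oppr_le0|
    rewrite max_l ?sub0r ?opprK// oppr_ge0 ltW].
have absE : (fun x => `|u x|) = p + 1 *: n.
  apply/funext => x; rewrite -[RHS]/(p x + 1 * n x) mul1r nE /p.
  have [u0|u0] := lerP 0 (u x).
    by rewrite ger0_norm// max_r ?addr0 ?oppr_le0.
  by rewrite ltr0_norm// max_l ?add0r// oppr_ge0 ltW.
have cross : a p n <= 0.
  (* The positive part of p - l n is p, so a(p, p) <= a(p - l n, p - l n); expand and divide by
     l. *)
  have le l : 0 < l -> 2 * a p n <= l * a n n.
    move=> l0.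
    have Dw : dom a (p + (- l) *: n).
      by apply: (pf_domD _ _ aP) => //; exact: (pf_domZ _ _ aP).
    have wE x : (p + (- l) *: n) x = p x - l * n x.
      by rewrite -[LHS]/(p x + - l * n x) mulNr.
    have [|] := form_pos_part _ ((1 + l) * M) Dw.
      move=> x; rewrite wE (le_trans (ler_normB _ _))// mulrDl mul1r lerD//.
        rewrite ger0_norm// /p (le_trans _ (uM x))//.
        by rewrite ge_max ler_norm normr_ge0.
      rewrite normrM gtr0_norm// ler_pM2l// ger0_norm// nE (le_trans _ (uM x))//.
      by rewrite ge_max normr_ge0 -normrN ler_norm.
    rewrite (_ : (fun x => _) = p).
      move=> _; rewrite (pf_sqrD _ _ aP)// => h.
      rewrite -(ler_pM2l l0); move: h; lra.
    apply/funext => x; rewrite wE nE /p.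
    have [u0|u0] := lerP 0 (u x).
      by rewrite [Num.max (- _) _]max_r ?oppr_le0// mulr0 subr0 max_l.
    have h : 0 <= - u x by rewrite oppr_ge0 ltW.
    by rewrite (max_l h) max_r// sub0r oppr_le0 mulr_ge0// ltW.
  rewrite leNgt; apply/negP => gt0.
  have nn := pf_ge0 _ _ aP _ Dn.
  (* If a(p, n) > 0, this l contradicts [le]; adding 1 keeps the divisor positive. *)
  have := le (a p n / (a n n + 1)).
  rewrite divr_gt0 ?ltr_wpDl// => /(_ isT).
  rewrite mulrAC ler_pdivlMr ?ltr_wpDl//.
  have := mulr_ge0 (ltW gt0) nn; lra.
rewrite absE; split.
  by apply: (pf_domD _ _ aP) => //; exact: (pf_domZ _ _ aP).
(* The form at |u| minus the form at u is 4 a(p, n). *)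
rewrite {1 2}uE (pf_sqrB _ _ aP)// (pf_sqrD _ _ aP)//; lra.
Qed.

Context (mu : {measure set (borel E) -> \bar R}).
Hypothesis mu_radon : radon mu.
Hypothesis amu_psd : psd (schrodinger a mu).
Local Notation b := (schrodinger a mu).

Lemma schrodinger_psd_form : psd_form (dom b) b.
Proof.
have bulk u v : dom b u -> dom b v ->
    mu.-integrable [set: borel E] (EFin \o (fun x => u x * v x)).
  by move=> [_ Cu] [_ Cv]; exact: C0_integrable_mul.
have bP c u v : dom b u -> dom b v -> dom b (c *: u + v).
  move=> [Du Cu] [Dv Cv]; split; last exact: C0_linear.
  exact: (pf_domP _ _ aP).
split => //.
- split; [exact: (pf_dom0 _ _ aP)|exact: C0_cst0].
- move=> c u v w bu bv bw; rewrite /= (pf_linear _ _ aP); [|by case: bu|by case: bv|by case: bw].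
  have -> : (\int[mu]_x ((c *: u + v) x * w x))%R =
      c * (\int[mu]_x (u x * w x))%R + (\int[mu]_x (v x * w x))%R.
    have iu := bulk _ _ bu bw; have iv := bulk _ _ bv bw.
    have Ccu : @C0 R E (c *: u).
      by rewrite -[_ *: _]addr0; apply: C0_linear C0_cst0; case: bu.
    have icu := C0_integrable_mul _ _ _ mu_radon Ccu bw.2.
    have -> : (\int[mu]_x ((c *: u + v) x * w x))%R =
        (\int[mu]_x ((c *: u) x * w x + v x * w x))%R.
      by apply: eq_Rintegral => x _; rewrite -mulrDl.
    rewrite RintegralD//; congr (_ + _); rewrite -RintegralZl//.
    by apply: eq_Rintegral => x _; rewrite /= mulrA.
  ring.
- move=> u v [Du _] [Dv _]; rewrite /= (pf_sym _ _ aP)//; congr (_ - _).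
  by apply: eq_Rintegral => x _; rewrite mulrC.
Qed.

(** The modulus keeps u^2 and hence the mu-term, so the bound for a is inherited; C_0 functions are
    bounded, as [form_abs] requires. *)
Lemma schrodinger_abs u : dom b u ->
  let v := fun x => `|u x| in dom b v /\ b v v <= b u u.
Proof.
move=> [Du Cu] /=; have [M uM] := C0_bounded _ Cu.
have [Dv av] := form_abs _ _ Du uM; split; first by split => //; exact: C0_norm.
have -> : (\int[mu]_x (`|u x| * `|u x|))%R = (\int[mu]_x (u x * u x))%R.
  by apply: eq_Rintegral => x _; rewrite -normrM ger0_norm// -expr2 sqr_ge0.
by rewrite lerD2r.
Qed.

Hypothesis a_regular : regular m a.
Local Notation L2T := (LfunType m (lee1n 2)).

(** Approximate in dom a, then in the core by regularity; the [form1] norm dominates the L^2 norm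
    since a is non-negative. *)
Lemma schrodinger_dense (x : L2T) (e : R) : 0 < e ->
  exists2 y : L2T, dom b y & seminorm (ipL m) (x - y) < e.
Proof.
move=> e0; have ipP := ipL_psd m.
have e2 : 0 < e / 2 by lra.
have [u Du xu] := dom_dense a_symm (L2T_L2 _ x) e2.
have [U UE] := L2_subproof _ _ (dom_L2 a_symm Du).
have [v [Dv Cv] uv] := a_regular.1 u _ Du (exprn_gt0 2 e2).
have [W WE] := L2_subproof _ _ (dom_L2 a_symm Dv).
exists W; first by rewrite WE.
have xU : seminorm (ipL m) (x - U) < e / 2.
  by rewrite -lte_fin -L2norm_seminorm; rewrite -UE in xu.
have UW : seminorm (ipL m) (U - W) < e / 2.
  rewrite -(@ltr_pXn2r _ 2)// ?nnegrE ?seminorm_ge0 ?(ltW e2)//.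
  rewrite (sqr_seminorm _ _ ipP)//; apply: le_lt_trans uv.
  rewrite -[leLHS]/(ip m (U \- W) (U \- W)) UE WE /form1 lerDr.
  by apply: (form_psd a_symm); exact: (pf_domB _ _ aP).
have xUW := seminorm_trans _ _ ipP U x W I I I.
by rewrite (le_lt_trans xUW)// [ltRHS]splitr ltrD.
Qed.

End Core.

(** * The closed form and its semigroup on square-integrable functions *)

Section FormClosure.
Context {R : realType} {E : pmetricType R}.
Variable m : {measure set (borel E) -> \bar R}.
Local Notation L2T := (LfunType m (lee1n 2)).
Local Notation ipL := (ipL m).
Local Notation nm := (seminorm ipL).
Local Notation ipP := (ipL_psd m).

Lemma cvg_EFinP T (F : set_system T) (FF : Filter F) (f : T -> R) (l : R) :
  (f x)%:E @[x --> F] --> l%:E <-> f x @[x --> F] --> l.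
Proof.
split => [/fine_cvgP[_]//|fl].
by apply: cvg_EFin => //; exact: nearW.
Qed.

Context (b : l2form E).
Hypothesis b_L2 : dom b `<=` L2 m.
Hypothesis b_psd : psd_form (dom b) b.
Hypothesis b_closable : closable m b.
Hypothesis b_dense : forall (x : L2T) (e : R), 0 < e ->
  exists2 y : L2T, dom b y & nm (x - y) < e.
Hypothesis b_abs : forall u, dom b u ->
  let v := fun x => `|u x| in dom b v /\ b v v <= b u u.

(** The abstract results take an inner product that is bilinear on the whole space, so the form is
    carried over to [L2T]. *)
Definition coreL : set L2T := [set f | dom b f].
Definition formL (f g : L2T) : R := b f g.
Definition closureL (f g : L2T) : R := form_closure m b f g.

Lemma formL_psd : psd_form coreL formL.
Proof.
split.
- exact: (pf_dom0 _ _ b_psd).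
- by move=> c u v; exact: (pf_domP _ _ b_psd).
- by move=> c u v w; exact: (pf_linear _ _ b_psd).
- by move=> u v; exact: (pf_sym _ _ b_psd).
- by move=> u; exact: (pf_ge0 _ _ b_psd).
Qed.

Lemma L2T_lift (s : nat -> E -> R) : (forall n, L2 m (s n)) ->
  exists S : nat -> L2T, (fun n => S n : E -> R) = s.
Proof.
move=> sL; have /choice[S HS] : forall n, exists f : L2T, f = s n :> (E -> R).
  by move=> n; exact: L2_subproof.
by exists S; apply/funext.
Qed.

Lemma L2cvgP (S : nat -> L2T) (u : L2T) :
  L2cvg m (fun n => S n) u <-> nm (S n - u) @[n --> \oo] --> (0 : R).
Proof.
rewrite -cvg_EFinP /L2cvg.
have -> // : (fun n => L2norm m (S n \- u)) = (fun n => (nm (S n - u))%:E).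
by apply/funext => n; rewrite -L2norm_seminorm.
Qed.

Lemma approximatesP (u : L2T) (S : nat -> L2T) :
  approximates ipL coreL formL u S <-> closure_approx m b u (fun n => S n).
Proof. by split => -[Ds Cs /L2cvgP su]; split. Qed.

Lemma closure_domP (u : L2T) :
  closure_dom ipL coreL formL u <-> dom (form_closure m b) u.
Proof.
split => [[S /approximatesP uS]|[_ [s us]]].
  by split; [exact: L2T_L2|eexists; exact: uS].
have [Ds _ _] := us; have [S SE] := L2T_lift s (fun n => b_L2 _ (Ds n)).
by exists S; apply/approximatesP; rewrite SE.
Qed.

Lemma formL_closable s : (forall n, coreL (s n)) -> form_cauchy formL s ->
  nm (s n) @[n --> \oo] --> (0 : R) -> formL (s n) (s n) @[n --> \oo] --> (0 : R).
Proof.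
move=> Ds Cs s0; apply: b_closable => //.
suff : L2cvg m (fun n => s n) (0 : L2T) by [].
by apply/L2cvgP; under eq_fun do rewrite subr0.
Qed.

Lemma closureL_spec u v : closure_dom ipL coreL formL u ->
  closure_dom ipL coreL formL v ->
  exists s s', [/\ approximates ipL coreL formL u s,
    approximates ipL coreL formL v s' &
    closureL u v = limn (fun n => formL (s n) (s' n))].
Proof.
move=> /closure_domP[_ ue] /closure_domP[_ ve].
have uP := getPex ue; have vP := getPex ve.
have [Du _ _] := uP; have [Dv _ _] := vP.
have [S SE] := L2T_lift _ (fun n => b_L2 _ (Du n)).
have [S' SE'] := L2T_lift _ (fun n => b_L2 _ (Dv n)).
exists S, S'; split; [by apply/approximatesP; rewrite SE|
  by apply/approximatesP; rewrite SE'|].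
rewrite /closureL /=; congr (limn _); apply/funext => n.
by rewrite /formL -[S n : E -> R]/((fun n => S n : E -> R) n) SE
  -[S' n : E -> R]/((fun n => S' n : E -> R) n) SE'.
Qed.

Lemma closureL_psd : psd_form (closure_dom ipL coreL formL) closureL.
Proof.
exact: (closure_psd_form _ ipP _ _ formL_psd formL_closable _ closureL_spec).
Qed.

(** Apply [ae_le_lim] to - u <= 0 + (s n - u). *)
Lemma nonneg_closed (s : nat -> L2T) (u : L2T) :
  (forall n, {ae m, forall x, 0 <= s n x}) ->
  nm (s n - u) @[n --> \oo] --> (0 : R) -> {ae m, forall x, 0 <= u x}.
Proof.
move=> s0 su; suff : {ae m, forall x, - u x <= 0}.
  by apply: filterS => x; rewrite oppr_le0.
apply: (ae_le_lim _ _ _ (fun _ _ => 0) (fun=> 0) su) => [n|].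
  apply: filterS (s0 n) => x; rewrite add0r -[(_ - _ : L2T) x]/(s n x - u x); lra.
by apply: nearW => x; exact: cvg_cst.
Qed.

Lemma nonneg_projection (f : L2T) : {ae m, forall x, 0 <= f x} ->
  forall s, coreL s -> exists s', [/\ coreL s', {ae m, forall x, 0 <= s' x},
    formL s' s' <= formL s s, ipL s' s' = ipL s s & ipL f s <= ipL f s'].
Proof.
move=> f0 s /b_abs[Ds' bs'].
have [s' sE] := L2_subproof _ _ (b_L2 _ Ds').
exists s'; split.
- by rewrite /coreL/= sE.
- by apply: nearW => x; rewrite sE.
- by rewrite /formL sE.
- apply: eq_Rintegral => x _; rewrite sE -normrM ger0_norm//.
  by rewrite -expr2 sqr_ge0.
- by apply: ipL_le; apply: filterS f0 => x f0; rewrite sE ler_wpM2l// ler_norm.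
Qed.

Lemma resolvents_exist : exists Rs : R -> L2T -> L2T, forall h f, 0 < h ->
  [/\ closure_dom ipL coreL formL (Rs h f),
    {ae m, forall x, 0 <= f x} -> {ae m, forall x, 0 <= Rs h f x} &
    forall w, closure_dom ipL coreL formL w ->
      h * closureL (Rs h f) w + ipL (Rs h f) w = ipL f w].
Proof.
have /choice[Rs HRs] : forall hf : R * L2T, exists u : L2T, 0 < hf.1 ->
    [/\ closure_dom ipL coreL formL u,
    {ae m, forall x, 0 <= hf.2 x} -> {ae m, forall x, 0 <= u x} &
    forall w, closure_dom ipL coreL formL w ->
      hf.1 * closureL u w + ipL u w = ipL hf.2 w].
  (* The default 0 for h <= 0 lets [choice] produce a total function. *)
  move=> [h f]; have [h0|h0] := pselect (0 < h); last by exists 0 => /h0.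
  have [u Hu] := resolvent_exists _ ipP _ _ formL_psd formL_closable _
    closureL_spec (ipL_complete m) [set u : L2T | {ae m, forall x, 0 <= u x}]
    _ f h0 nonneg_closed (@nonneg_projection f).
  by exists u.
by exists (fun h f => Rs (h, f)) => h f h0; exact: (HRs (h, f)).
Qed.

Context (T : R -> (E -> R) -> (E -> R)).
Hypothesis T_semigroup : semigroup_of m (form_closure m b) T.

(** Realises T_t as a map on [L2T] and adds what [semigroup_of] does not contain: positivity and the
    two bounds on f - T_t f. *)
Theorem semigroup_positive_decrement (t : R) : 0 < t ->
  exists P : L2T -> L2T, [/\ forall f : L2T, P f = T t f :> (E -> R),
    forall f : L2T, {ae m, forall x, 0 <= f x} -> {ae m, forall x, 0 <= P f x},
    forall f : L2T, nm (f - P f) ^+ 2 <= ipL (f - P f) f &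
    forall f : L2T, dom (form_closure m b) f ->
      ipL (f - P f) f <= t * form_closure m b f f].
Proof.
move=> t0.
have /choice[U HU] : forall tf : R * L2T, exists g : L2T, 0 < tf.1 ->
    g = T tf.1 tf.2 :> (E -> R).
  move=> [s f]; have [s0|s0] := pselect (0 < s); last by exists 0 => /s0.
  have [g gE] := L2_subproof _ _ (semigroup_L2 T_semigroup s0 (L2T_L2 _ f)).
  by exists g.
pose V s f := U (s, f).
have VE s f : 0 < s -> V s f = T s f :> (E -> R) by move=> s0; exact: (HU (s, f)).
have aeF := ae_filter_ringOfSetsType m.
have nm0 (f g : L2T) : {ae m, forall x, f x = g x} -> nm (f - g) = 0.
  move=> fg; rewrite (nm_ae _ (f - g) 0).
    by rewrite /seminorm (pf0l _ _ ipP)// sqrtr0.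
  by apply: filterS fg => x fg; rewrite L2TB fg subrr.
have V_linear s c (f g : L2T) : 0 < s -> nm (V s (c *: f + g) - (c *: V s f + V s g)) = 0.
  move=> s0; apply: nm0.
  have lin : {ae m, forall x, T s (fun y => c * f y + g y) x = c * T s f x + T s g x}.
    exact: (semigroup_linear T_semigroup c s0 (L2T_L2 _ f) (L2T_L2 _ g)).
  apply: filterS lin => x; rewrite VE// -[(_ + _ : L2T) x]/(c * V s f x + V s g x) !VE//.
have V_contraction s f : 0 < s -> nm (V s f) <= nm f.
  move=> s0; rewrite -lee_fin -!L2norm_seminorm VE//.
  exact: (semigroup_contraction T_semigroup s0 (L2T_L2 _ f)).
have V_sym s f g : 0 < s -> ipL (V s f) g = ipL f (V s g).
  move=> s0; rewrite /ipL !VE//.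
  exact: (semigroup_sym T_semigroup s0 (L2T_L2 _ f) (L2T_L2 _ g)).
have V_add s r f : 0 < s -> 0 < r -> nm (V (s + r) f - V s (V r f)) = 0.
  move=> s0 r0; apply: nm0.
  have add : {ae m, forall x, T (s + r) f x = T s (T r f) x}.
    exact: (semigroupD T_semigroup s0 r0 (L2T_L2 _ f)).
  by apply: filterS add => x; rewrite !VE// addr_gt0.
have V_generator u g : nm (s^-1 *: (V s u - u) - g) @[s --> 0^'+] --> (0 : R) <->
    in_generator ipL (closure_dom ipL coreL formL) closureL u g.
  rewrite -cvg_EFinP.
  have := semigroup_generator T_semigroup (L2T_L2 _ u) (L2T_L2 _ g).
  have -> : (L2norm m (fun x => s^-1 * (T s u x - u x) - g x) @[s --> 0^'+] --> 0%E) =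
     ((nm (s^-1 *: (V s u - u) - g))%:E @[s --> 0^'+] --> 0%:E).
    (* V s represents T s for s > 0, which is all that a limit at 0 from the right sees. *)
    have near_eq : \forall s \near (0 : R)^'+,
        L2norm m (fun x => s^-1 * (T s u x - u x) - g x) =
        (nm (s^-1 *: (V s u - u) - g))%:E.
      near=> s; have s0 : 0 < s by [].
      by rewrite -L2norm_seminorm -VE.
    by apply/propext; split; apply: cvg_trans; apply: near_eq_cvg => //;
      apply: filterS near_eq => s ->.
  move=> ->; split=> [[Du qu]|[Du qu]].
    split; first exact/closure_domP.
    by move=> v /closure_domP Dv; exact: qu.
  split; first exact/closure_domP.
  move=> v Dv; have [w wE] := L2_subproof _ _ Dv.1; rewrite -wE in Dv *.
  by apply: qu; exact/closure_domP.
have [Rs HRs] := resolvents_exist.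
have Rs_dom h f : 0 < h -> closure_dom ipL coreL formL (Rs h f).
  by move=> h0; case: (HRs h f h0).
have Rs_cone h (f : L2T) : 0 < h -> {ae m, forall x, 0 <= f x} -> {ae m, forall x, 0 <= Rs h f x}.
  by move=> h0; case: (HRs h f h0).
have Rs_eq h f w : 0 < h -> closure_dom ipL coreL formL w ->
    h * closureL (Rs h f) w + ipL (Rs h f) w = ipL f w.
  by move=> h0; case: (HRs h f h0) => _ _; exact.
have dense (x : L2T) (e : R) : 0 < e ->
    exists2 y, closure_dom ipL coreL formL y & nm (x - y) < e.
  move=> e0; have [y Dy xy] := b_dense x _ e0; exists y => //.
  exact: (core_sub_closure _ ipP _ _ formL_psd).
exists (V t); split => [f|f f0|f|f Df].
- exact: VE.
- exact (T_cone _ ipP _ _ closureL_psd dense V V_linear V_contraction V_add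
    V_generator [set u : L2T | {ae m, forall x, 0 <= u x}] Rs nonneg_closed
    Rs_dom Rs_cone Rs_eq t f t0 f0).
- exact: (sqr_decrement _ ipP V V_contraction V_sym V_add).
- exact: (form_decrement _ ipP _ _ closureL_psd V V_linear V_contraction V_sym
    V_add V_generator Rs Rs_dom Rs_eq t f t0 ((closure_domP f).2 Df)).
Unshelve. all: by end_near. Qed.

End FormClosure.

(** * The ground state *)

Section Main.
Context {R : realType} {E : pmetricType R}.
Variable m : {measure set (borel E) -> \bar R}.
Local Notation L2T := (LfunType m (lee1n 2)).

(* The strictly positive bounded integrable function g provided by transience
   makes min(Phi, n |g|) an increasing sequence in L^2 converging to Phi. *)
Lemma monotone_approx_exists (a : l2form E) (phi : E -> \bar R) (Phi : E -> R) :
  transient m a -> measurable_fun [set: borel E] Phi -> (forall x, 0 <= Phi x) ->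
  {ae m, forall x, phi x = (Phi x)%:E} ->
  exists s, monotone_approx m phi s.
Proof.
have aeF := ae_filter_ringOfSetsType m.
move=> [g [gL1 [M gM] g0 _]] mPhi Phi0 phiE.
have mg : measurable_fun [set: borel E] g by move: gL1 => /andP[+ _]; rewrite inE.
have mng : measurable_fun [set: borel E] (fun x => `|g x|) by exact: measurableT_comp.
(* g^2 <= M |g|, which is integrable. *)
have gL2 : L2 m g.
  apply: L2P => //.
  have /Lfun1_integrable/integrableP[_ gi] := gL1.
  have M0 : 0 <= M := le_trans (normr_ge0 _) (gM point).
  apply: (@le_lt_trans _ _ (M%:E * \int[m]_x (`|g x|)%:E)%E); last first.
    by rewrite lte_mul_pinfty// lee_fin.
  rewrite -ge0_integralZl_EFin//; last exact/measurable_EFinP.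
  apply: ge0_le_integral => //=.
  - by move=> x _; rewrite lee_fin sqr_ge0.
  - by apply/measurable_EFinP; exact: measurable_funX.
  - by apply/measurable_EFinP; exact: measurable_funM.
  - move=> x _; rewrite -EFinM lee_fin -[leLHS]real_normK ?num_real// expr2.
    by rewrite ler_wpM2r.
pose s n x := Num.min (Phi x) (n%:R * `|g x|).
exists s; split.
- move=> n; apply: (L2_le m _ (fun x => n%:R * g x)).
  + by apply: measurable_minr => //; exact: measurable_funM.
  + have [G GE] := L2_subproof _ _ gL2; rewrite -GE.
    exact: (L2T_L2 _ (n%:R *: G : L2T)).
  + move=> x; rewrite /s normrM normr_nat [`|Num.min _ _|]ger0_norm ?ge_min ?lexx ?orbT//.
    by rewrite le_min Phi0 mulr_ge0.
- move=> n; apply: nearW => x; rewrite /s le_min Phi0 mulr_ge0//=.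
  by rewrite le_min ge_min lexx/= ge_min ler_wpM2r ?orbT// ler_nat.
- apply: filterS2 g0 phiE => x g0 ->; apply: cvg_EFin; first exact: nearW.
  apply: cvg_near_cst.
  (* Where g > 0 the sequence is constant from this n on. *)
  have [n Hn] : exists n : nat, Phi x / `|g x| <= n%:R.
    exists (Num.trunc (Phi x / `|g x|)).+1.
    by rewrite ltW// truncnS_gt.
  exists n => // k /= nk; rewrite /s min_l//.
  by rewrite -ler_pdivrMr ?normr_gt0 ?gt_eqF// (le_trans Hn)// ler_nat.
Qed.

End Main.

Theorem lemma2p4 (R : realType) (E : pmetricType R)
  (E_lc : locally_compact [set: E]) (E_sep : separable E)
  (m : {measure set (borel E) -> \bar R})
  (m_radon : radon m) (m_supp : full_support m)
  (a : l2form E) (a_dirichlet : dirichlet_form m a) (a_regular : regular m a)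
  (S : R -> (E -> R) -> (E -> R)) (S_semigroup : semigroup_of m a S)
  (a_irreducible : irreducible m S) (a_transient : transient m a)
  (mu : {measure set (borel E) -> \bar R})
  (mu_radon : radon mu) (mu_smooth : smooth m a mu)
  (amu_psd : psd (schrodinger a mu)) (amu_closable : closable m (schrodinger a mu))
  (T : R -> (E -> R) -> (E -> R))
  (T_semigroup : semigroup_of m (form_closure m (schrodinger a mu)) T)
  (amu_critical : critical m (form_closure m (schrodinger a mu)))
  (phi : E -> \bar R)
  (phi_ground : ground_state m (form_closure m (schrodinger a mu)) phi) :
  Hplus m T phi /\
  forall t : R, 0 < t -> {ae m, forall x, monotone_ext m (T t) phi x = phi x}.
Proof.
have [a_symm _ a_markov] := a_dirichlet.
pose b := schrodinger a mu; pose q := form_closure m b.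
have aeF := ae_filter_ringOfSetsType m.
have [[phi_meas phi_fin [s0 s0P]] phi_pos phi_energy] := phi_ground.
have b_L2 : dom b `<=` L2 m by move=> u [Du _]; exact: (dom_L2 a_symm).
have b_psd : psd_form (dom b) b.
  exact: (schrodinger_psd_form m a a_symm mu mu_radon amu_psd).
have [v mv phiv] := phi_meas.
(* A Borel version of phi that is real and non-negative at every point, as [invariant_limit]
   requires. *)
pose Phi x := Num.max (fine (v x)) 0.
have mPhi : measurable_fun [set: borel E] Phi.
  by apply: measurable_maxr => //; exact: measurableT_comp.
have Phi0 x : 0 <= Phi x by rewrite le_max lexx orbT.
have phiE : {ae m, forall x, phi x = (Phi x)%:E}.
  apply: filterS3 phiv phi_fin phi_pos => x pv pf pp.
  rewrite pv in pf pp *; rewrite /Phi.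
  have vfin : v x \is a fin_num by rewrite fin_num_abs.
  by rewrite -{1}(fineK vfin) max_l// fine_ge0// ltW.
have inv (t : R) : 0 < t -> {ae m, forall x, monotone_ext m (T t) phi x = phi x}.
  move=> t0.
  have [P [PE P_ge0 P_dec P_form]] := semigroup_positive_decrement m b b_L2 b_psd
    amu_closable (schrodinger_dense m a a_symm mu a_regular)
    (schrodinger_abs m a a_symm a_markov mu) T T_semigroup t t0.
  (* The sequence that [extended_form] uses, so that [phi_energy] speaks of it. *)
  pose s := get (extended_approx m q phi).
  have [Ds Cs sphi] : extended_approx m q phi s by apply: getPex; exists s0.
  have [u uE] := L2T_lift m s (fun n => (Ds n).1).
  have uE' n : u n = s n :> (E -> R) by rewrite -uE.
  have u_cvg : {ae m, forall x, u n x @[n --> \oo] --> Phi x}.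
    apply: filterS2 sphi phiE => x + px; rewrite px => /cvg_EFinP.
    by rewrite -uE.
  (* [phi_energy] only gives the value of a [limn]; convergence comes from s being q-Cauchy. *)
  have q_cvg : q (s n) (s n) @[n --> \oo] --> (0 : R).
    rewrite -phi_energy /extended_form -/s.
    have qP := closureL_psd m b b_L2 b_psd amu_closable.
    have Cu : form_cauchy (closureL m b) u.
      move=> e e0; have [N HN] := Cs e e0; exists N => i j Ni Nj.
      by have := HN i j Ni Nj; rewrite -!uE'.
    have Du n : closure_dom (ipL m) (coreL m b) (formL m b) (u n).
      by apply/closure_domP => //; rewrite uE'; exact: Ds.
    have -> : (fun n => q (s n) (s n)) = (fun n => closureL m b (u n) (u n)).
      by apply/funext => n; rewrite /closureL uE'.
    exact: (form_cauchy_cvg _ _ qP u Du Cu).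
  (* Squeezed between 0, by [P_dec], and t q(u_n, u_n), by [P_form]. *)
  have u_dec : ipL m (u n - P (u n)) (u n) @[n --> \oo] --> (0 : R).
    have : t * q (s n) (s n) @[n --> \oo] --> (0 : R).
      by rewrite -[X in _ --> X](mulr0 t); apply: cvgM => //; exact: cvg_cst.
    apply: cvgr0_le; apply: nearW => n.
    rewrite (le_trans (sqr_ge0 _) (P_dec (u n)))/=.
    by rewrite -uE' P_form// uE'; exact: Ds.
  have [f_L2 f_mono f_cvg] : monotone_approx m phi (get (monotone_approx m phi)).
    by apply: getPex; exact: monotone_approx_exists a_transient mPhi Phi0 phiE.
  have [f fE] := L2T_lift m _ f_L2.
  have fE' n : f n = get (monotone_approx m phi) n :> (E -> R) by rewrite -fE.
  have := invariant_limit m P.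
  have P_lin c g h : {ae m, forall x, P (c *: g + h) x = c * P g x + P h x}.
    have lin := semigroup_linear T_semigroup c t0 (L2T_L2 _ g) (L2T_L2 _ h).
    by apply: filterS lin => x; rewrite !PE.
  have P_contr g : seminorm (ipL m) (P g) <= seminorm (ipL m) g.
    rewrite -lee_fin -!L2norm_seminorm PE.
    exact: (semigroup_contraction T_semigroup t0 (L2T_L2 _ g)).
  have P_sym g h : ipL m (P g) h = ipL m g (P h).
    by rewrite /ipL !PE; exact: (semigroup_sym T_semigroup t0 (L2T_L2 _ g) (L2T_L2 _ h)).
  move=> /(_ P_lin P_ge0 P_contr P_sym P_dec Phi mPhi Phi0 u u_cvg u_dec f) lim.
  have : {ae m, forall x, P (f n) x @[n --> \oo] --> Phi x}.
    apply: lim.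
    - by move=> n; apply: filterS (f_mono n) => x; rewrite -!fE'.
    - apply: filterS2 f_cvg phiE => x + px; rewrite px => /cvg_EFinP.
      by rewrite -fE.
  apply: filterS2 phiE => x px Pf; rewrite px /monotone_ext.
  apply: cvg_lim => //; apply/cvg_EFinP.
  rewrite (_ : (fun n => _) = (fun n => P (f n) x))//.
  by apply/funext => n; rewrite PE fE'.
split => //; split => //.
- by apply: filterS2 phiE phi_pos => x -> ->; rewrite ltry.
- by move=> t t0; apply: filterS (inv t t0) => x ->.
Qed.
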